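(* For $a\in\mathbb{Q}$, let $$E_a:\ y^2=x^3+(a^4-4a^3-2a^2-4a+1)x^2+16a^4x,$$ and assume $E_a$ is nonsingular. Then the torsion subgroup of $E_a(\mathbb{Q})$ is isomorphic to $\mathbb{Z}/2\mathbb{Z}\times\mathbb{Z}/8\mathbb{Z}$ if and only if $$a=-\frac{r+1}{r(r-1)}$$ for some $r\in\mathbb{Q}\setminus\{0,1,-1\}$.
   Context: The family $E_a$ arises from bicentric quadrilaterals, i.e. convex quadrilaterals having both a circumscribed circle and an inscribed circle, with rational sides. In general the torsion subgroup of $E_a(\mathbb{Q})$ is $\mathbb{Z}/8\mathbb{Z}$. *)

(* Defs.v *)
From HB Require Import structures.
From mathcomp Require Import all_boot all_order all_algebra.
Set Implicit Arguments. Unset Strict Implicit. Unset Printing Implicit Defensive.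
Import Order.TTheory GRing.Theory Num.Theory.
Local Open Scope ring_scope.

(* Elliptic curves over Q of the form  y^2 = x^3 + A x^2 + B x
   (Weierstrass coefficients a1 = a3 = a6 = 0, a2 = A, a4 = B).
   A point of E(Q) is None (the point at infinity O) or Some (x, y). *)
Definition point := option (rat * rat).

Definition on_curve (A B : rat) (P : point) : bool :=
  match P with
  | None => true
  | Some (x, y) => y ^+ 2 == x ^+ 3 + A * x ^+ 2 + B * x
  end.

Definition disc (A B : rat) : rat := 16 * B ^+ 2 * (A ^+ 2 - 4 * B).

Definition ec_add (A B : rat) (P Q : point) : point :=
  match P, Q with
  | None, _ => Q
  | _, None => P
  | Some (x1, y1), Some (x2, y2) =>
      if (x1 == x2) && (y1 == - y2) then None
      else
        let l := if x1 == x2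
                 then (3 * x1 ^+ 2 + 2 * A * x1 + B) / (2 * y1)
                 else (y2 - y1) / (x2 - x1) in
        let x3 := l ^+ 2 - A - x1 - x2 in
        Some (x3, l * (x1 - x3) - y1)
  end.

Fixpoint ec_mul (A B : rat) (n : nat) (P : point) : point :=
  match n with
  | 0 => None
  | n'.+1 => ec_add A B P (ec_mul A B n' P)
  end.

Definition is_torsion (A B : rat) (P : point) : Prop :=
  on_curve A B P /\ exists n : nat, (0 < n)%N /\ ec_mul A B n P = None.

Definition torsion_Z2xZ8 (A B : rat) : Prop :=
  exists f : 'Z_2 * 'Z_8 -> point,
    injective f /\
    (forall u v, f (u + v) = ec_add A B (f u) (f v)) /\
    (forall P, is_torsion A B P <-> exists u, f u = P).

Definition EA (a : rat) : rat := a ^+ 4 - 4 * a ^+ 3 - 2 * a ^+ 2 - 4 * a + 1.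
Definition EB (a : rat) : rat := 16 * a ^+ 4.

(* Main.v *)
Require Import Defs.
From HB Require Import structures.
From mathcomp Require Import all_boot all_order all_algebra.
From mathcomp Require Import ring lra zify.
Import Order.TTheory GRing.Theory Num.Theory.
Local Open Scope ring_scope.
Set Implicit Arguments. Unset Strict Implicit. Unset Printing Implicit Defensive.

(** Write [a = - (r + 1) / (r (r - 1))] and let [u : v = 2 r : r^2 - 1] in lowest
    terms, so that [u^2 + v^2] is a square. Up to scaling, [E_a] is the curve
    [y^2 = x (x + u^4) (x + v^4)], which visibly contains [Z/2 x Z/8]; the point
    is to show that it has no further rational torsion, and for this Mazur's
    theorem is not needed. Suppose [P = 8 S <> O] with [S] torsion. By
    Nagell-Lutz the nonzero multiples of [S] have integral [x]. If [P = 2 Q]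
    then [x(P)], [x(P) + u^4], [x(P) + v^4] are squares [X^2], [Y^2], [Z^2], and
    for suitable signs [x(Q) = (X + Y) (X + Z)],
    [x(Q) + u^4 = (X + Y) (Y + Z)], [x(Q) + v^4 = (X + Z) (Y + Z)]; these are
    squares too, because [Q] is again a double. Since
    [(Y + X) (Y - X) = u^4] and [(Z + X) (Z - X) = v^4] with [u], [v] coprime,
    these factors are squares [a^2], [b^2], [c^2], [d^2], and
    [Y + Z = a^2 + d^2] is a square. Going one step further down the tower of
    halves shows that [a] and [d] are themselves squares or doubles of squares,
    contradicting Fermat's theorems on [x^4 + y^4 = z^2] and [x^4 + 4 y^4 = z^2].
    Conversely, two rational points of order two make [a^2 - 6 a + 1] a square,
    and this conic is parametrized by [r]. *)

(** * The group law *)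

Section LinearCombinations.
Variable R : comRingType.
Implicit Types x y z t : R.
(** A goal follows from a known equation once both have the same difference of sides, which is left
    to [ring]; [eqD], [eqB] and [eqM] build that equation as a linear combination of hypotheses. *)
Lemma eq_lin x y z t : x = y -> z - t = x - y -> z = t.
Proof. by move=> -> /eqP; rewrite subrr subr_eq0 => /eqP. Qed.
Lemma eqD x y z t : x = y -> z = t -> x + z = y + t.
Proof. by move=> -> ->. Qed.
Lemma eqB x y z t : x = y -> z = t -> x - z = y - t.
Proof. by move=> -> ->. Qed.
Lemma eqM z x y : x = y -> z * x = z * y.
Proof. by move=> ->. Qed.
End LinearCombinations.
Ltac linear_combination e := apply: (eq_lin e); ring.

(* The last three equations are Vieta's formulas for
   [x^3 + A x^2 + B x - (l x + c)^2 = (x - x1) (x - x2) (x - x3)]: the line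
   [y = l x + c] cuts the curve at [(x1, y1)], [(x2, y2)], [(x3, - y3)] with
   multiplicity, so that chords and tangents are treated uniformly. *)
Definition third_point (A B x1 y1 x2 y2 x3 y3 l c : rat) : Prop :=
  [/\ y1 = l * x1 + c, y2 = l * x2 + c & y3 = - (l * x3 + c)] /\
  [/\ x1 + x2 + x3 = l ^+ 2 - A, x1 * x2 + x1 * x3 + x2 * x3 = B - 2 * l * c
    & x1 * x2 * x3 = c ^+ 2].

Lemma third_point_sym A B x1 y1 x2 y2 x3 y3 l c :
  third_point A B x1 y1 x2 y2 x3 y3 l c -> third_point A B x2 y2 x1 y1 x3 y3 l c.
Proof.
case=> [[? ? ?] [h1 h2 h3]]; split; split=> //.
- by rewrite -h1; ring.
- by rewrite -h2; ring.
- by rewrite -h3; ring.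
Qed.

(** Reflecting the line in the x-axis turns [P1 + P2 = P3] into [- P1 + P3 = P2]; this yields
    cancellation in [ec_addKl]. *)
Lemma third_point_rot A B x1 y1 x2 y2 x3 y3 l c :
  third_point A B x1 y1 x2 y2 x3 y3 l c ->
  third_point A B x1 (- y1) x3 y3 x2 y2 (- l) (- c).
Proof.
case=> [[-> -> ->] [h1 h2 h3]]; split; split; [ring|ring|ring|..].
- by rewrite sqrrN -h1; ring.
- linear_combination h2.
- by rewrite sqrrN -h3; ring.
Qed.

Lemma third_point_opp A B x1 y1 x2 y2 x3 y3 l c :
  third_point A B x1 y1 x2 y2 x3 y3 l c ->
  third_point A B x1 (- y1) x2 (- y2) x3 (- y3) (- l) (- c).
Proof.
case=> [[-> -> ->] [h1 h2 h3]]; split; split; [ring|ring|ring|..].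
- by rewrite sqrrN.
- linear_combination h2.
- by rewrite sqrrN.
Qed.

Lemma third_point_curve A B x1 y1 x2 y2 x3 y3 l c :
  third_point A B x1 y1 x2 y2 x3 y3 l c -> on_curve A B (Some (x3, y3)).
Proof.
case=> [[_ _ ->] [h1 h2 h3]] /=; apply/eqP.
linear_combination (eqM (-1) (eqD (eqB (eqM (x3 ^+ 2) h1) (eqM x3 h2)) h3)).
Qed.

(** Trades the case analysis of [ec_add] for polynomial identities, so that each group axiom becomes
    a computation with lines. *)
Lemma ec_add_SomeP A B x1 y1 x2 y2 x3 y3 :
  disc A B != 0 -> on_curve A B (Some (x1, y1)) -> on_curve A B (Some (x2, y2)) ->
  ec_add A B (Some (x1, y1)) (Some (x2, y2)) = Some (x3, y3) <->
  exists l c, third_point A B x1 y1 x2 y2 x3 y3 l c.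
Proof.
move=> ns /eqP e1 /eqP e2; split.
  rewrite /ec_add; case: (eqVneq x1 x2) e2 => [<-|x12] /= e2; last first.
    case=> + <- => <-.
    set l := _ / _.
    have hd : x2 - x1 != 0 by rewrite subr_eq0 eq_sym.
    have {l} [l -> hl] : exists2 l', l = l' & l' * (x2 - x1) = y2 - y1.
      by exists l; rewrite // /l divfK.
    exists l, (y1 - l * x1).
    have y2E : y2 = y1 + l * (x2 - x1) by rewrite hl; ring.
    (* The difference of the two curve equations, divided by [x2 - x1]. *)
    have hk : l * (2 * y1 + l * (x2 - x1)) =
        x1 ^+ 2 + x1 * x2 + x2 ^+ 2 + A * (x1 + x2) + B.
      apply: (mulIf hd); move: e2; rewrite y2E => e2.
      linear_combination (eqB e2 e1).
    split; split; [ring|by rewrite y2E; ring|ring|ring|..].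
      linear_combination hk.
    linear_combination (eqB (eqM x1 hk) e1).
  case: ifP => // hy [] + <- => <-.
  have y12 : y1 = y2.
    have : (y1 - y2) * (y1 + y2) = 0 by rewrite -subr_sqr e1 e2 subrr.
    by move/eqP; rewrite mulf_eq0 [y1 + y2 == 0]addr_eq0 hy orbF subr_eq0 => /eqP.
  have hy2 : 2 * y1 != 0.
    by rewrite mulf_neq0 //; apply: contraFneq hy => h0; rewrite -y12 h0 oppr0.
  set l := _ / _.
  have {l} [l -> hl] : exists2 l', l = l' & l' * (2 * y1) = 3 * x1 ^+ 2 + 2 * A * x1 + B.
    by exists l; rewrite // /l divfK.
  exists l, (y1 - l * x1).
  split; split; [ring|by rewrite y12; ring|ring|ring|..].
    linear_combination hl.
  linear_combination (eqB (eqM x1 hl) e1).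
case=> l [c [[y1E y2E y3E] [h1 h2 h3]]].
have AE : A = l ^+ 2 - (x1 + x2 + x3) by linear_combination h1.
have BE : B = x1 * x2 + x1 * x3 + x2 * x3 + 2 * l * c.
  linear_combination (eqM (- 1) h2).
rewrite /ec_add; case: (eqVneq x1 x2) => [x12|x12] /=; last first.
  have -> : (y2 - y1) / (x2 - x1) = l.
    rewrite y1E y2E; have hd : x2 - x1 != 0 by rewrite subr_eq0 eq_sym.
    by field.
  congr (Some (_, _)); first by rewrite AE; ring.
  by rewrite y3E y1E AE; ring.
rewrite -x12 in y2E h1 h2 h3 AE BE *.
have y12 : y2 = y1 by rewrite y1E y2E.
(* A non-vertical line with double contact at a point with [y1 = 0] makes that point singular:
   either [B = 0], or [A = - 2 x1] and [B = x1 ^+ 2]. *)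
have y10 : y1 != 0.
  apply: contra ns => /eqP y10.
  have cE : c = - (l * x1) by linear_combination (eqM (- 1) (etrans (esym y10) y1E)).
  have : x1 ^+ 2 * (l ^+ 2 - x3) = 0 by move: h3; rewrite cE => h3; linear_combination (eqM (-1) h3).
  move/eqP; rewrite mulf_eq0 expf_eq0 /= subr_eq0 /disc AE BE cE => /orP[] /eqP => [->|<-]; apply/eqP; ring.
rewrite y12 -subr_eq0 opprK -mulr2n mulrn_eq0 (negPf y10) /=.
have -> : (3 * x1 ^+ 2 + 2 * A * x1 + B) / (2 * y1) = l.
  apply: (canLR (mulfK _)); first by rewrite mulf_neq0.
  by rewrite AE BE y1E; ring.
congr (Some (_, _)); first by rewrite AE; ring.
by rewrite y3E y1E AE; ring.
Qed.

(* The slope [l + n - m] comes from the fact that, on the curve, the product of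
   the lines [P1 P2], [P4 P3] and [x = x5] equals that of the lines [P2 P3],
   [P1 P5] and [x = x4]; compare the coefficients of [x^2 y]. *)
Lemma third_point_assoc A B x1 y1 x2 y2 x3 y3 x4 y4 x5 y5 x6 y6 l c m d n e :
  disc A B != 0 -> on_curve A B (Some (x2, y2)) -> on_curve A B (Some (x3, y3)) ->
  third_point A B x1 y1 x2 y2 x4 y4 l c ->
  third_point A B x2 y2 x3 y3 x5 y5 m d ->
  third_point A B x4 y4 x3 y3 x6 y6 n e ->
  third_point A B x1 y1 x5 y5 x6 y6 (l + n - m) (- (l + n) * x5 - d).
Proof.
move=> ns on2 on3 [[y1E y2E y4E] [a1 a2 a3]] tp2.
case: (tp2) => [[y2E' y3E y5E] [b1 b2 b3]].
case=> [[y4E' y3E' y6E] [c1 c2 c3]].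
have dE : d = c - (m - l) * x2.
  linear_combination (etrans (esym y2E') y2E).
have eE : e = - (l + n) * x4 - c.
  linear_combination (etrans (esym y4E') y4E).
have s1 : m * x3 + d = n * x3 + e by rewrite -y3E.
(* The whole lemma rests on [K]. It is obtained up to the factor [x3 - x4] and, when this vanishes,
   up to the factor [x3 - x2]. If both vanish, then [P3 = - P2], and [P2 + P3] is not an affine
   point. *)
have K4 : (x3 - x4) * (x3 - x1 - (l + n) * (m - l)) = 0.
  rewrite dE eE in s1; rewrite dE in b2.
  linear_combination
    (eqD (eqD (eqM (x2 + x3) (eqB b1 a1)) (eqB a2 b2)) (eqM (m - l) s1)).
have K2 : x3 = x4 -> (x3 - x2) * (x3 - x1 - (l + n) * (m - l)) = 0.
  move=> x34; have s2 : m * x3 + d = - (l * x3 + c).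
    by rewrite -y3E y3E' {1}x34 -y4E' y4E x34.
  rewrite dE in s2; rewrite eE -x34 in c2; rewrite -x34 in a1 a2 c1.
  linear_combination (eqD (eqM (- (l + n)) s2)
    (eqM (- 1) (eqB (eqB c2 a2) (eqM (2 * x3) (eqB c1 a1))))).
have K : x3 = x1 + (l + n) * (m - l).
  case: (eqVneq x3 (x1 + (l + n) * (m - l))) => // nK.
  have nK0 : x3 - x1 - (l + n) * (m - l) != 0 by rewrite -addrA -opprD subr_eq0.
  move/eqP: K4; rewrite mulf_eq0 (negPf nK0) orbF subr_eq0 => /eqP x34.
  move/eqP: (K2 x34); rewrite mulf_eq0 (negPf nK0) orbF subr_eq0 => /eqP x32.
  have y23 : y2 = y3 by rewrite y2E' y3E x32.
  have y34 : y3 = y4 by rewrite y3E' y4E' x34.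
  have y20 : y2 = - y3 by rewrite y34 y4E -x34 x32 -y2E opprK.
  have /(ec_add_SomeP _ _ ns on2 on3) : exists m d, third_point A B x2 y2 x3 y3 x5 y5 m d.
    by exists m, d.
  by rewrite /ec_add -x32 -y20 !eqxx.
have x5E : x5 = x4 + (m - l) * (m - n).
  move: (eqB b1 a1); rewrite K => h; linear_combination h.
have x6E : x6 = x2 + (n - m) * (n + l).
  move: (eqB c1 a1); rewrite K => h; linear_combination h.
have AE : A = l ^+ 2 - (x1 + x2 + x4) by linear_combination a1.
have BE : B = x1 * x2 + x1 * x4 + x2 * x4 + 2 * l * c.
  linear_combination (eqM (- 1) a2).
move: s1 b3; rewrite y1E y5E y6E AE BE eE x5E x6E dE K => s1 b3.
split; split.
- linear_combination s1.
- ring.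
- ring.
- ring.
- linear_combination (eqM (m - 2 * l - n) s1).
- linear_combination (eqB b3 (eqM ((x4 + (m - l) * (m - n)) * (l + n)) s1)).
Qed.

(** * Negation and the group of rational points *)

Definition ec_opp (P : point) : point :=
  if P is Some (x, y) then Some (x, - y) else None.

Lemma ec_oppK : involutive ec_opp.
Proof. by case=> [[x y]|] //=; rewrite opprK. Qed.

Lemma ec_add_eq_None A B P Q : ec_add A B P Q = None <-> P = ec_opp Q.
Proof.
case: P Q => [[x1 y1]|] [[x2 y2]|] //=.
by case: ifP => [/andP[/eqP -> /eqP ->]|hn] //; split=> // -[x12 y12]; rewrite x12 y12 !eqxx in hn.
Qed.

Lemma ec_addr0 A B P : ec_add A B P None = P.
Proof. by case: P => [[]|]. Qed.

Section GroupLaw.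
Variables A B : rat.
Hypothesis ns : disc A B != 0.
Local Notation on := (on_curve A B).
Local Notation "P +' Q" := (ec_add A B P Q) (at level 50, left associativity).
Local Notation third := (third_point A B).

Lemma on_ec_opp P : on (ec_opp P) = on P.
Proof. by case: P => [[x y]|] //=; rewrite sqrrN. Qed.

Lemma on_ec_add P Q : on P -> on Q -> on (P +' Q).
Proof.
case: P Q => [[x1 y1]|] [[x2 y2]|] // onP onQ.
case E: (Some (x1, y1) +' Some (x2, y2)) => [[x3 y3]|] //.
have /(ec_add_SomeP _ _ ns onP onQ) [l [c]] := E.
exact: third_point_curve.
Qed.

Lemma ec_addC P Q : on P -> on Q -> P +' Q = Q +' P.
Proof.
case: P Q => [[x1 y1]|] [[x2 y2]|] // onP onQ.
case E: (Some (x1, y1) +' Some (x2, y2)) => [[x3 y3]|]; apply/esym.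
  have /(ec_add_SomeP _ _ ns onP onQ) [l [c h]] := E.
  by apply/(ec_add_SomeP _ _ ns onQ onP); exists l, c; apply: third_point_sym.
by have /ec_add_eq_None -> := E; apply/ec_add_eq_None; rewrite ec_oppK.
Qed.

Lemma ec_oppD P Q : on P -> on Q -> ec_opp (P +' Q) = ec_opp P +' ec_opp Q.
Proof.
case: P Q => [[x1 y1]|] [[x2 y2]|] // onP onQ.
have onP' : on (Some (x1, - y1)) by have := onP; rewrite -on_ec_opp.
have onQ' : on (Some (x2, - y2)) by have := onQ; rewrite -on_ec_opp.
case E: (Some (x1, y1) +' Some (x2, y2)) => [[x3 y3]|]; apply/esym.
  have /(ec_add_SomeP _ _ ns onP onQ) [l [c h]] := E.
  apply/(ec_add_SomeP _ _ ns onP' onQ'); exists (- l), (- c).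
  exact: third_point_opp.
by have /ec_add_eq_None -> := E; apply/ec_add_eq_None; rewrite !ec_oppK.
Qed.

(** Associativity for opposite points. It settles the cases of [ec_addA] where some intermediate sum
    is [None]; the remaining case is [third_point_assoc]. *)
Lemma ec_addKl P Q : on P -> on Q -> ec_opp P +' (P +' Q) = Q.
Proof.
case: P Q => [[x1 y1]|] [[x2 y2]|] // onP onQ; last first.
  by rewrite ec_addr0; apply/ec_add_eq_None.
have onP' : on (Some (x1, - y1)) by have := onP; rewrite -on_ec_opp.
case E: (Some (x1, y1) +' Some (x2, y2)) => [[x3 y3]|].
  have onR := on_ec_add onP onQ; rewrite E in onR.
  have /(ec_add_SomeP _ _ ns onP onQ) [l [c h]] := E.
  apply/(ec_add_SomeP _ _ ns onP' onR); exists (- l), (- c).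
  exact: third_point_rot.
by have /ec_add_eq_None -> := E; rewrite ec_addr0 ec_oppK.
Qed.

Lemma ec_addA P Q R : on P -> on Q -> on R -> P +' (Q +' R) = (P +' Q) +' R.
Proof.
move=> onP onQ onR.
case: (eqVneq P None) => [->|P0] //; case: (eqVneq Q None) => [->|Q0].
  by rewrite ec_addr0.
case: (eqVneq R None) => [->|R0]; first by rewrite !ec_addr0.
case E12: (P +' Q) => [[x4 y4]|]; last first.
  by have /ec_add_eq_None -> := E12; rewrite ec_addKl.
case E23: (Q +' R) => [[x5 y5]|]; last first.
  have /(congr1 ec_opp) := proj1 (ec_add_eq_None _ _ _ _) E23; rewrite ec_oppK => <-.
  have onS := on_ec_add onP onQ.
  by rewrite -E12 ec_addr0 ec_addC ?on_ec_opp // (ec_addC onP) // ec_addKl.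
have on4 := on_ec_add onP onQ; have on5 := on_ec_add onQ onR.
rewrite E12 in on4; rewrite E23 in on5.
case E123: (Some (x4, y4) +' R) => [[x6 y6]|]; last first.
  apply/ec_add_eq_None; rewrite -E23.
  have /(congr1 ec_opp) := proj1 (ec_add_eq_None _ _ _ _) E123; rewrite ec_oppK => <-.
  by rewrite -E12 ec_oppD ?on_ec_opp ?on_ec_add // ec_oppK (ec_addC onP) // ec_addKl.
case: P P0 onP E12 => [[x1 y1]|] // _ onP E12.
case: Q Q0 onQ E12 E23 => [[x2 y2]|] // _ onQ E12 E23.
case: R R0 onR E23 E123 => [[x3 y3]|] // _ onR E23 E123.
have /(ec_add_SomeP _ _ ns onP onQ) [l [c h1]] := E12.
have /(ec_add_SomeP _ _ ns onQ onR) [m [d h2]] := E23.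
have /(ec_add_SomeP _ _ ns on4 onR) [n [e h3]] := E123.
apply/(ec_add_SomeP _ _ ns onP on5); exists (l + n - m), (- (l + n) * x5 - d).
exact: (third_point_assoc ns onQ onR h1 h2 h3).
Qed.

Definition ecpt := {P : point | on P}.
HB.instance Definition _ := Choice.on ecpt.

Definition ecpt0 : ecpt := exist _ None isT.
Definition ecpt_opp (P : ecpt) : ecpt :=
  exist _ (ec_opp (val P)) (etrans (on_ec_opp _) (valP P)).
Definition ecpt_add (P Q : ecpt) : ecpt :=
  exist _ (val P +' val Q) (on_ec_add (valP P) (valP Q)).

Lemma ecpt_addA : associative ecpt_add.
Proof. by move=> P Q R; apply: val_inj; apply: ec_addA; apply: valP. Qed.
Lemma ecpt_addC : commutative ecpt_add.
Proof. by move=> P Q; apply: val_inj; apply: ec_addC; apply: valP. Qed.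
Lemma ecpt_add0 : left_id ecpt0 ecpt_add.
Proof. by move=> P; apply: val_inj. Qed.
Lemma ecpt_addN : left_inverse ecpt0 ecpt_opp ecpt_add.
Proof. by move=> P; apply: val_inj; apply/ec_add_eq_None. Qed.

End GroupLaw.
(** The proof of nonsingularity is an argument of the type, so that the [Zmodule] instance, whose
    laws depend on it, can be inferred from the type alone. *)
Definition ecgroup A B & disc A B != 0 := ecpt A B.
HB.instance Definition _ A B ns := Choice.on (@ecgroup A B ns).
HB.instance Definition _ A B ns := GRing.isZmodule.Build (@ecgroup A B ns)
  (ecpt_addA ns) (ecpt_addC ns) (ecpt_add0 ns) (ecpt_addN ns).

Section EcGroup.
Variables (A B : rat) (ns : disc A B != 0).
Implicit Types P Q : ecgroup ns.
Lemma val_ecD P Q : val (P + Q) = ec_add A B (val P) (val Q). Proof. by []. Qed.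
Lemma val_ec0 : val (0 : ecgroup ns) = None. Proof. by []. Qed.
Lemma val_ecMn P n : val (P *+ n) = ec_mul A B n (val P).
Proof. by elim: n => [|n IH] //; rewrite mulrS val_ecD IH. Qed.
Lemma is_torsionP (P : point) :
  is_torsion A B P <-> exists (Q : ecgroup ns) n, [/\ val Q = P, (0 < n)%N & Q *+ n = 0].
Proof.
split=> [[onP [n [n0 nP]]]|[Q [n [<- n0 nQ]]]].
  by exists (exist _ P onP), n; split=> //; apply: val_inj; rewrite val_ecMn.
by split; [apply: valP | exists n; rewrite -val_ecMn nQ].
Qed.
End EcGroup.

(** * Fermat's descents *)

Section Fermat.
Local Open Scope nat_scope.

Lemma gcdn_sqr m n : gcdn (m ^ 2) (n ^ 2) = gcdn m n ^ 2.
Proof.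
case: (posnP m) => [->|m0]; first by rewrite !gcd0n.
have [/dvdnP[a ma] /dvdnP[b nb]] := (dvdn_gcdl m n, dvdn_gcdr m n).
have g0 : 0 < gcdn m n by rewrite gcdn_gt0 m0.
have ab : coprime a b.
  by rewrite /coprime -(eqn_pmul2r g0) muln_gcdl -ma -nb mul1n.
move: ma nb; set g := gcdn m n => -> ->; rewrite !expnMn -muln_gcdl.
by have /eqP -> := coprimeXl 2 (coprimeXr 2 ab); rewrite mul1n.
Qed.

(** The root is [gcdn a n]: its square is gcd(a^2, a b) = a gcd(a, b) = a. *)
Lemma coprime_mul_sqr a b n : coprime a b -> a * b = n ^ 2 -> exists m, a = m ^ 2.
Proof.
move=> /eqP ab abn; exists (gcdn a n).
by rewrite -gcdn_sqr -abn expnSr expn1 -muln_gcdr ab muln1.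
Qed.

Lemma coprime_of_dvd a b a' b' : a' %| a -> b' %| b -> coprime a b -> coprime a' b'.
Proof. by move=> ha hb ab; apply: coprime_dvdl ha (coprime_dvdr hb ab). Qed.

(** With z = x + 2 a and y = 2 b the equation reads a (x + a) = b^2, a product of coprime factors,
    which are therefore q^2 and p^2. The first leg is given as [x + q ^ 2 = p ^ 2] to avoid
    truncated subtraction. *)
Lemma pythagorean_triple x y z : coprime x y -> ~~ odd y -> x ^ 2 + y ^ 2 = z ^ 2 ->
  exists p q, [/\ coprime p q, x + q ^ 2 = p ^ 2, y = 2 * (p * q) & z = p ^ 2 + q ^ 2].
Proof.
move=> xy yev e.
have xo : odd x.
  apply: contraLR xy => xev; rewrite /coprime; apply/eqP => h.
  have : 2 %| gcdn x y by rewrite dvdn_gcd !dvdn2 xev yev.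
  by rewrite h.
have zo : odd z.
  by have := congr1 odd e; rewrite oddD !oddX /= xo (negPf yev).
have [a za] : exists a, z = x + 2 * a.
  have xz : x <= z by rewrite -(leq_exp2r _ _ (isT : 0 < 2)) -e leq_addr.
  exists (z - x)./2; rewrite mul2n even_halfK ?subnKC //.
  by rewrite oddB // xo zo.
have [b yb] : exists b, y = 2 * b by exists y./2; rewrite mul2n even_halfK.
have ab : a * (x + a) = b ^ 2 by move: e; rewrite za yb; nia.
have co : coprime a (x + a).
  rewrite /coprime gcdnDr -/(coprime _ _) coprime_sym.
  apply: coprime_dvdr (coprimeXr 2 xy); apply: (@dvdn_trans (b ^ 2)).
    by rewrite -ab dvdn_mulr.
  by rewrite yb expnMn dvdn_mull.
have [q aq] := coprime_mul_sqr co ab.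
rewrite coprime_sym mulnC in co ab.
have [p xp] := coprime_mul_sqr co ab.
exists p, q; split.
- by move: co; rewrite xp aq coprime_pexpl // coprime_pexpr.
- by rewrite -xp aq.
- rewrite yb; congr (2 * _); apply/eqP; rewrite -(eqn_exp2r _ _ (isT : 0 < 2)).
  by rewrite -ab xp aq expnMn.
- rewrite za -xp -aq; lia.
Qed.

Lemma coprime_double_mul_sqr m n k : coprime m n -> odd m -> 2 * (m * n) = k ^ 2 ->
  exists a b, m = a ^ 2 /\ n = 2 * b ^ 2.
Proof.
move=> mn mo e.
have co : coprime m (2 * n) by rewrite coprimeMr mn andbT coprime_sym coprime2n.
have [a ma] : exists a, m = a ^ 2 by apply: (coprime_mul_sqr (n := k) co); rewrite -e; lia.
have [b nb] : exists b, 2 * n = b ^ 2.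
  by apply: (@coprime_mul_sqr _ m k); rewrite 1?coprime_sym // -e; lia.
have bev : ~~ odd b by have := congr1 odd nb; rewrite oddM oddX /= => <-.
exists a, b./2; split=> //.
have : b = 2 * b./2 by rewrite mul2n even_halfK.
nia.
Qed.

Lemma coprime_even_odd x y : coprime x y -> ~~ odd y -> odd x.
Proof.
move=> xy yev; apply: contraLR xy => xev; rewrite /coprime; apply/eqP => h.
have : 2 %| gcdn x y by rewrite dvdn_gcd !dvdn2 xev yev.
by rewrite h.
Qed.

(** The left side is 2 modulo 4. *)
Lemma sqr_ne_odd_sqrD x y z : odd x -> odd y -> x ^ 2 + y ^ 2 <> z ^ 2.
Proof.
move=> xo yo e; have zev : ~~ odd z.
  by have := congr1 odd e; rewrite oddD !oddX /= xo yo => <-.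
have zE : z = 2 * z./2 by rewrite mul2n even_halfK.
have xE : x = 1 + 2 * x./2 by rewrite mul2n -{1}(odd_double_half x) xo.
have yE : y = 1 + 2 * y./2 by rewrite mul2n -{1}(odd_double_half y) yo.
move: e; rewrite zE xE yE; nia.
Qed.

Lemma primitive_leg p q x : coprime p q -> x + q ^ 2 = p ^ 2 -> coprime x q.
Proof.
move=> pq xE; rewrite -(@coprime_pexpr 2) // coprime_sym /coprime -gcdnDr xE.
by apply: coprimeXl; apply: coprimeXr; rewrite coprime_sym.
Qed.

(** Makes both descents decrease: there z = p^2 + q^2 with p = P^2, and the new hypotenuse is P. *)
Lemma ltn_fourth_sqrD m n : 0 < n -> m < (m ^ 2) ^ 2 + n ^ 2.
Proof.
move=> n0; rewrite -expnM; apply: (@leq_ltn_trans (m ^ 4)).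
  by case: m => // m; rewrite -{1}[m.+1]expn1 leq_pexp2l.
by rewrite -addn1 leq_add2l expn_gt0 n0.
Qed.

(** Infinite descent on z. With y even, the triple (x^2, y^2, z) gives y^2 = 2 p q, so p = P^2 and q
    = 2 Q^2. The triple (x, q, p) then gives m n = Q^2, so m = M^2, n = N^2 and M^4 + N^4 = P^2. *)
Lemma fermat_x4_plus_y4_coprime x y z : coprime x y -> 0 < x -> 0 < y ->
  x ^ 4 + y ^ 4 <> z ^ 2.
Proof.
elim/ltn_ind: z x y => z IH x y.
wlog yev : x y / ~~ odd y.
  move=> W xy x0 y0; case: (boolP (odd y)) => [yo|yev]; last exact: W.
  case: (boolP (odd x)) => [xo|xev]; last by rewrite addnC; apply: W; rewrite 1?coprime_sym.
  rewrite (expnM x 2 2) (expnM y 2 2); apply: sqr_ne_odd_sqrD; by rewrite oddX.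
move=> xy x0 y0 e.
have [] := @pythagorean_triple (x ^ 2) (y ^ 2) z.
- by rewrite coprime_pexpl // coprime_pexpr.
- by rewrite oddX.
- by rewrite -!expnM.
move=> p [q [pq xE yE zE]].
have xo := coprime_even_odd xy yev.
have qev : ~~ odd q by apply/negP => qo; apply: sqr_ne_odd_sqrD xo qo xE.
have [P [Q [pE qE]]] := coprime_double_mul_sqr pq (coprime_even_odd pq qev) (esym yE).
have xq := primitive_leg pq xE; rewrite coprime_pexpl // in xq.
have [] := @pythagorean_triple x q p xq qev xE.
move=> m [n [mn mE qmn pmn]].
have mnQ : m * n = Q ^ 2 by lia.
have [M mM] := coprime_mul_sqr mn mnQ.
have [N nN] : exists N, n = N ^ 2.
  by apply: (@coprime_mul_sqr n m Q); rewrite 1?coprime_sym // mulnC.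
have q0 : 0 < q.
  have : 0 < y ^ 2 by rewrite expn_gt0 y0.
  by rewrite yE !muln_gt0 => /and3P[].
have Q0 : 0 < Q by move: q0; rewrite qE muln_gt0 expn_gt0 orbF.
have [m0 n0] : 0 < m /\ 0 < n by apply/andP; rewrite -muln_gt0 mnQ expn_gt0 Q0.
apply: (IH P _ M N).
- by rewrite zE pE ltn_fourth_sqrD.
- by move: mn; rewrite mM nN coprime_pexpl // coprime_pexpr.
- by move: m0; rewrite mM expn_gt0 orbF.
- by move: n0; rewrite nN expn_gt0 orbF.
- by rewrite -pE pmn mM nN -!expnM.
Qed.

(** The same descent from the triple (x^2, 2 y^2, z): now p = P^2 and q = Q^2, and (x, q, p) gives 2
    m n = Q^2 with m^2 + n^2 = P^2. *)
Lemma fermat_x4_plus_4y4_coprime x y z : coprime x y -> 0 < x -> 0 < y -> odd x ->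
  x ^ 4 + 4 * y ^ 4 <> z ^ 2.
Proof.
elim/ltn_ind: z x y => z IH x y xy x0 y0 xo e.
have [] := @pythagorean_triple (x ^ 2) (2 * y ^ 2) z.
- by rewrite coprimeMr coprimen2 coprime_pexpl // coprime_pexpr // oddX xo.
- by rewrite oddM.
- by rewrite -e expnMn -!expnM.
move=> p [q [pq xE yE zE]].
have yE' : p * q = y ^ 2 by lia.
have [P pE] := coprime_mul_sqr pq yE'.
have [Q qE] : exists Q, q = Q ^ 2.
  by apply: (@coprime_mul_sqr q p y); rewrite 1?coprime_sym // mulnC.
have qev : ~~ odd q by apply/negP => qo; apply: sqr_ne_odd_sqrD xo qo xE.
have xq := primitive_leg pq xE; rewrite coprime_pexpl // in xq.
have [] := @pythagorean_triple x q p xq qev xE.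
move=> m [n [mn mE qmn pmn]].
have q0 : 0 < q.
  have : 0 < y ^ 2 by rewrite expn_gt0 y0.
  by rewrite -yE' muln_gt0 => /andP[].
have Q0 : 0 < Q by move: q0; rewrite qE expn_gt0 orbF.
have Pz : P < z by rewrite zE pE ltn_fourth_sqrD.
(* Whichever of [m], [n] is odd becomes M^2 and the other 2 N^2, so that M^4 + 4 N^4 = P^2. *)
have done_ m' n' : coprime m' n' -> odd m' -> 2 * (m' * n') = Q ^ 2 ->
    P ^ 2 = m' ^ 2 + n' ^ 2 -> False.
  move=> co mo mnQ PE.
  have [M [N [mM nN]]] := coprime_double_mul_sqr co mo mnQ.
  apply: (IH P Pz M N).
  - move: co; rewrite mM nN coprimeMr coprime_pexpl // coprime_pexpl // coprime_pexpr //.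
    by case/andP.
  - by case: (M) mM mo => // ->.
  - have : 0 < 2 * (m' * n') by rewrite mnQ expn_gt0 Q0.
    by rewrite !muln_gt0 nN muln_gt0 expn_gt0 orbF => /and3P[].
  - by move: mo; rewrite mM oddX.
  - by rewrite PE mM nN expnMn -!expnM.
case: (boolP (odd m)) => mo.
  by apply: done_ mn mo _ _; rewrite -?qmn -?qE -?pE.
rewrite coprime_sym in mn.
by apply: (done_ n m mn (coprime_even_odd mn mo)); rewrite 1?(mulnC n) 1?[n ^ _ + _]addnC -?qmn -?qE -?pE.
Qed.

Lemma gcd_split x y : 0 < x -> exists g x' y',
  [/\ 0 < g, coprime x' y', x = g * x' & y = g * y'].
Proof.
move=> x0; have g0 : 0 < gcdn x y by rewrite gcdn_gt0 x0.
have [/dvdnP[a ma] /dvdnP[b nb]] := (dvdn_gcdl x y, dvdn_gcdr x y).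
exists (gcdn x y), a, b; split; rewrite 1?mulnC //.
by rewrite /coprime -(eqn_pmul2r g0) muln_gcdl -ma -nb mul1n.
Qed.

Lemma fermat_x4_plus_y4 x y z : 0 < x -> 0 < y -> x ^ 4 + y ^ 4 <> z ^ 2.
Proof.
move=> x0 y0; have [g [a [b [g0 ab xE yE]]]] := gcd_split y x0.
rewrite xE yE !expnMn -mulnDr => e.
have /dvdnP[w zE] : g ^ 2 %| z.
  by rewrite -(dvdn_pexp2r _ _ (isT : 0 < 2)) -e -expnM dvdn_mulr.
have a0 : 0 < a by move: x0; rewrite xE muln_gt0 => /andP[].
have b0 : 0 < b by move: y0; rewrite yE muln_gt0 => /andP[].
apply: (@fermat_x4_plus_y4_coprime a b w) => //.
apply/eqP; rewrite -(eqn_pmul2l (_ : 0 < g ^ 4)) ?expn_gt0 ?g0 // e zE expnMn.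
by rewrite -expnM mulnC.
Qed.

(** After division by the gcd, an odd first entry is the coprime case. An even one, a = 2 a' with w
    = 2 w', turns a^4 + 4 b^4 = w^2 into b^4 + 4 a'^4 = w'^2, with a smaller right side. *)
Lemma fermat_x4_plus_4y4 x y z : 0 < x -> 0 < y -> x ^ 4 + 4 * y ^ 4 <> z ^ 2.
Proof.
elim/ltn_ind: z x y => z IH x y x0 y0.
have [g [a [b [g0 ab xE yE]]]] := gcd_split y x0.
have a0 : 0 < a by move: x0; rewrite xE muln_gt0 => /andP[].
have b0 : 0 < b by move: y0; rewrite yE muln_gt0 => /andP[].
rewrite xE yE !expnMn mulnCA -mulnDr => e.
have /dvdnP[w zE] : g ^ 2 %| z.
  by rewrite -(dvdn_pexp2r _ _ (isT : 0 < 2)) -e -expnM dvdn_mulr.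
have e' : a ^ 4 + 4 * b ^ 4 = w ^ 2.
  apply/eqP; rewrite -(eqn_pmul2l (_ : 0 < g ^ 4)) ?expn_gt0 ?g0 // e zE expnMn.
  by rewrite -expnM mulnC.
case: (boolP (odd a)) => ao; first exact: fermat_x4_plus_4y4_coprime ab a0 b0 ao e'.
have wev : ~~ odd w by have := congr1 odd e'; rewrite oddD oddM !oddX /= (negPf ao) => <-.
have wE : w = 2 * w./2 by rewrite mul2n even_halfK.
have aE : a = 2 * a./2 by rewrite mul2n even_halfK.
apply: (IH w./2 _ b a./2) => //.
- have w0 : 0 < w by rewrite -(ltn_exp2r _ _ (isT : 0 < 2)) -e' addn_gt0 expn_gt0 a0.
  rewrite zE; apply: (@leq_trans w); first by lia.
  by rewrite leq_pmulr // expn_gt0 g0.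
- by case: (a) aE a0 => // [[|?]] //=.
- by move: e'; rewrite {1}aE {1}wE !expnMn; lia.
Qed.
End Fermat.

(** * Integral points divisible by eight *)

Section Descent.
Local Open Scope nat_scope.

Definition is_square n := exists m, n = m ^ 2.
Definition is_square_or_double n := exists m, n = m ^ 2 \/ n = 2 * m ^ 2.

Lemma is_square_mull m n : 0 < m -> is_square (m ^ 2 * n) -> is_square n.
Proof.
move=> m0 [k e]; have /dvdnP[w kE] : m %| k.
  by rewrite -(dvdn_pexp2r _ _ (isT : 0 < 2)) -e dvdn_mulr.
exists w; apply/eqP; rewrite -(eqn_pmul2l (_ : 0 < m ^ 2)) ?expn_gt0 ?m0 //.
by rewrite e kE expnMn mulnC.
Qed.

Lemma is_square_double n : is_square (2 * n) -> is_square_or_double n.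
Proof.
case=> k e; have kev : ~~ odd k by have := congr1 odd e; rewrite oddM oddX /= => <-.
have kE : k = 2 * k./2 by rewrite mul2n even_halfK.
by exists k./2; right; move: e; rewrite {1}kE expnMn; lia.
Qed.

Lemma is_square_or_double_cofactor c d :
  0 < c -> is_square_or_double c -> is_square (c * d) -> is_square_or_double d.
Proof.
move=> c0 [C [cE|cE]] cd.
  have C0 : 0 < C by move: c0; rewrite cE expn_gt0 orbF.
  have [m ->] : is_square d by apply: (is_square_mull C0); rewrite -cE.
  by exists m; left.
have C0 : 0 < C by move: c0; rewrite cE; case: (C).
apply/is_square_double/(is_square_mull C0).
by rewrite mulnA [C ^ 2 * 2]mulnC -cE.
Qed.

(** The gcd of [2 * c + k] and [k] divides 2, so the gcd of the two given squares, itself a square,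
    is [a] or [2 * a]. In the application [k = h - c], and the factors are h + c and h - c. *)
Lemma square_of_sum_diff a c k :
  coprime c k -> is_square (a * (2 * c + k)) -> is_square (a * k) ->
  is_square_or_double a.
Proof.
move=> ck [p pE] [q qE].
have gdvd : gcdn (2 * c + k) k %| 2.
  by rewrite gcdnC gcdnDr Gauss_gcdl ?dvdn_gcdr // coprime_sym.
have : a * gcdn (2 * c + k) k = gcdn p q ^ 2 by rewrite -gcdn_sqr -pE -qE muln_gcdr.
move: (gcdn _ k) gdvd => [|[|[|g]]] // gdvd e; last 1 first.
- by apply: is_square_double; exists (gcdn p q); rewrite mulnC.
- by exists (gcdn p q); left; rewrite -e muln1.
Qed.

(** The four cases are A^4 + D^4, A^4 + 4 D^4, 4 A^4 + D^4 and 4 (A^4 + D^4). *)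
Lemma no_sqrD_square_or_double a d h : 0 < a -> 0 < d ->
  is_square_or_double a -> is_square_or_double d -> a ^ 2 + d ^ 2 <> h ^ 2.
Proof.
have sgt0 m : 0 < m ^ 2 -> 0 < m by rewrite expn_gt0 orbF.
have dgt0 m : 0 < 2 * m ^ 2 -> 0 < m by case: m.
move=> a0 d0 [A aE] [D dE]; move: a0 d0; case: aE => ->; case: dE => ->.
- by move=> /sgt0 A0 /sgt0 D0; rewrite -!expnM; apply: fermat_x4_plus_y4.
- by move=> /sgt0 A0 /dgt0 D0; rewrite expnMn -!expnM; apply: fermat_x4_plus_4y4.
- by move=> /dgt0 A0 /sgt0 D0; rewrite expnMn -!expnM addnC; apply: fermat_x4_plus_4y4.
move=> /dgt0 A0 /dgt0 D0; rewrite (expnMn 2 (A ^ 2)) (expnMn 2 (D ^ 2)) -mulnDr -!expnM => e.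
have [w] : is_square (A ^ 4 + D ^ 4) by apply: (@is_square_mull 2) => //; exists h.
exact: fermat_x4_plus_y4.
Qed.

(** In the notation of the overview, [al] and [be] are Y + X and Y - X, [ga] and [de] are Z + X and
    Z - X (up to the sign of X), and [et] is Y + Z. Divisors of u^4 are coprime to divisors of v^4,
    and [et] is a sum of one of each in two ways; hence [al], [ga], [et] are pairwise coprime, and
    square products force square factors. *)
Lemma halving_squares u v al be ga de et : coprime u v -> 0 < u -> 0 < v ->
  al * be = u ^ 4 -> ga * de = v ^ 4 -> al + de = et -> be + ga = et ->
  is_square (al * ga) -> is_square (al * et) ->
  exists a b c d h, [/\ al = a ^ 2, be = b ^ 2, ga = c ^ 2, de = d ^ 2 & et = h ^ 2] /\
    [/\ 0 < a, 0 < c, 0 < d, a * b = u ^ 2 & c * d = v ^ 2] /\ coprime a h /\ coprime c h.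
Proof.
move=> uv u0 v0 abE gdE e1 e2 [m mE] [n nE].
have uv4 : coprime (u ^ 4) (v ^ 4) by rewrite coprime_pexpl // coprime_pexpr.
have alu : al %| u ^ 4 by rewrite -abE dvdn_mulr.
have beu : be %| u ^ 4 by rewrite -abE dvdn_mull.
have gav : ga %| v ^ 4 by rewrite -gdE dvdn_mulr.
have dev : de %| v ^ 4 by rewrite -gdE dvdn_mull.
have ag := coprime_of_dvd alu gav uv4.
have ae : coprime al et.
  by rewrite -e1 /coprime gcdnDl; apply: coprime_of_dvd alu dev uv4.
have ge : coprime ga et.
  by rewrite -e2 /coprime gcdnDr -/(coprime _ _) coprime_sym; apply: coprime_of_dvd beu gav uv4.
have [a aE] := coprime_mul_sqr ag mE.
have [c cE] : exists c, ga = c ^ 2.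
  by apply: (@coprime_mul_sqr ga al m); rewrite 1?coprime_sym // mulnC.
have [h hE] : exists h, et = h ^ 2.
  by apply: (@coprime_mul_sqr et al n); rewrite 1?coprime_sym // mulnC.
have u4 : 0 < u ^ 4 by rewrite expn_gt0 u0.
have v4 : 0 < v ^ 4 by rewrite expn_gt0 v0.
have a0 : 0 < a by have := dvdn_gt0 u4 alu; rewrite aE expn_gt0 orbF.
have c0 : 0 < c by have := dvdn_gt0 v4 gav; rewrite cE expn_gt0 orbF.
have d0 : 0 < de by exact: dvdn_gt0 v4 dev.
have [b bE] : is_square be.
  by apply: (is_square_mull a0); exists (u ^ 2); rewrite -aE abE -expnM.
have [d dE] : is_square de.
  by apply: (is_square_mull c0); exists (v ^ 2); rewrite -cE gdE -expnM.
exists a, b, c, d, h; split=> //; split; [split=> // | split].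
- by move: d0; rewrite dE expn_gt0 orbF.
- by apply/eqP; rewrite -(eqn_exp2r _ _ (isT : 0 < 2)) expnMn -aE -bE abE -expnM.
- by apply/eqP; rewrite -(eqn_exp2r _ _ (isT : 0 < 2)) expnMn -cE -dE gdE -expnM.
- by move: ae; rewrite aE hE coprime_pexpl // coprime_pexpr.
- by move: ge; rewrite cE hE coprime_pexpl // coprime_pexpr.
Qed.

(** The roots factor as x = a c, y = a h, z = c h, so the last four hypotheses say that a (h + c), a
    (h - c), c (h + a), c (h - a) are squares. Thus a and c are squares or doubles of squares, and
    so is d by c d = v^2; but a^2 + d^2 = [et] = h^2. *)
Lemma no_integral_halving u v al be ga de et x y z :
  coprime u v -> 0 < u -> 0 < v ->
  al * be = u ^ 4 -> ga * de = v ^ 4 -> al + de = et -> be + ga = et ->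
  al * ga = x ^ 2 -> al * et = y ^ 2 -> ga * et = z ^ 2 ->
  is_square (y + x) -> is_square (y - x) -> is_square (z + x) -> is_square (z - x) ->
  False.
Proof.
move=> uv u0 v0 abE gdE e1 e2 xE yE zE yx1 yx2 zx1 zx2.
have [] := halving_squares uv u0 v0 abE gdE e1 e2.
- by exists x.
- by exists y.
move=> a [b [c [d [h [[aE bE cE dE hE] [[a0 c0 d0 abu cdv] [ah ch]]]]]]].
have sqr_inj m n : m ^ 2 = n ^ 2 -> m = n.
  by move/eqP; rewrite eqn_exp2r // => /eqP.
have {}xE : x = a * c by apply: sqr_inj; rewrite -xE aE cE expnMn.
have {}yE : y = a * h by apply: sqr_inj; rewrite -yE aE hE expnMn.
have {}zE : z = c * h by apply: sqr_inj; rewrite -zE cE hE expnMn.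
(* These bounds keep the natural subtractions [h - c] and [h - a] from truncating. *)
have ch' : c <= h by rewrite -(leq_exp2r _ _ (isT : 0 < 2)) -cE -hE -e2 leq_addl.
have ah' : a <= h by rewrite -(leq_exp2r _ _ (isT : 0 < 2)) -aE -hE -e1 leq_addr.
have sa : is_square_or_double a.
  apply: (@square_of_sum_diff a c (h - c)).
  - by rewrite -(subnKC ch') /coprime gcdnDl in ch.
  - by move: yx1; rewrite yE xE -mulnDr mul2n -addnn -addnA subnKC // addnC.
  - by rewrite mulnBr -yE -xE.
have sc : is_square_or_double c.
  apply: (@square_of_sum_diff c a (h - a)).
  - by rewrite -(subnKC ah') /coprime gcdnDl in ah.
  - by move: zx1; rewrite zE xE [a * c]mulnC -mulnDr mul2n -addnn -addnA subnKC // addnC.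
  - by rewrite mulnBr -zE mulnC -xE.
have sd : is_square_or_double d.
  by apply: (is_square_or_double_cofactor c0 sc); exists v.
apply: (no_sqrD_square_or_double a0 d0 sa sd (h := h)).
by rewrite -aE -dE -hE.
Qed.
End Descent.

(** * Integrality of torsion points *)

Section LocalDivisibility.
Variable p : nat.
Hypothesis p_pr : prime p.

(* [x] lies in [p^k Z_(p)]. *)
Definition local_dvd (k : nat) (x : rat) : Prop :=
  exists m d : int, ~~ (p%:Z %| d)%Z /\ x * d%:~R = p%:R ^+ k * m%:~R.

Lemma prime_dvdzM (m n : int) : (p%:Z %| m * n)%Z = (p%:Z %| m)%Z || (p%:Z %| n)%Z.
Proof. by rewrite !dvdzE abszM Euclid_dvdM. Qed.

Lemma prime_ndvdz_neq0 (d : int) : ~~ (p%:Z %| d)%Z -> d%:~R != 0 :> rat.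
Proof. by apply: contra; rewrite intr_eq0 => /eqP ->; rewrite dvdz0. Qed.

Lemma local_dvdD k x y : local_dvd k x -> local_dvd k y -> local_dvd k (x + y).
Proof.
move=> [m [d [pd e]]] [m' [d' [pd' e']]]; exists (m * d' + m' * d), (d * d').
split; first by rewrite prime_dvdzM negb_or pd.
rewrite !rmorphD !rmorphM /= mulrDl mulrA e [d%:~R * _]mulrC mulrA e'; ring.
Qed.

Lemma local_dvdM j k x y : local_dvd j x -> local_dvd k y -> local_dvd (j + k) (x * y).
Proof.
move=> [m [d [pd e]]] [m' [d' [pd' e']]]; exists (m * m'), (d * d').
split; first by rewrite prime_dvdzM negb_or pd.
by rewrite !rmorphM /= mulrACA e e' exprD mulrACA.
Qed.

Lemma local_dvdN k x : local_dvd k x -> local_dvd k (- x).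
Proof.
by move=> [m [d [pd e]]]; exists (- m), d; rewrite mulNr e rmorphN mulrN.
Qed.

Lemma local_dvdB k x y : local_dvd k x -> local_dvd k y -> local_dvd k (x - y).
Proof. by move=> hx /local_dvdN; apply: local_dvdD. Qed.

Lemma local_dvd_int (m : int) : local_dvd 0 m%:~R.
Proof.
exists m, 1; rewrite mulr1 expr0 mul1r; split=> //.
by rewrite dvdz1 absz_nat; case: eqP p_pr => // ->.
Qed.

Lemma local_dvd0 k : local_dvd k 0.
Proof. by exists 0, 1; rewrite mul0r mulr0 dvdz1 absz_nat; split=> //; case: eqP p_pr => // ->. Qed.

Lemma local_dvdW j k x : (j <= k)%N -> local_dvd k x -> local_dvd j x.
Proof.
move=> jk [m [d [pd e]]]; exists (p%:Z ^+ (k - j) * m), d; split=> //.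
by rewrite e rmorphM rmorphXn /= mulrA -exprD subnKC.
Qed.

(** Elements of 1 + p Z_(p) are units of Z_(p); this permits the divisions in the formal
    estimates. *)
Lemma local_dvd_unit x : local_dvd 1 x -> 1 + x != 0 /\ local_dvd 0 (1 + x)^-1.
Proof.
move=> [m [d [pd e]]].
have pd1 : ~~ (p%:Z %| d + p%:Z * m)%Z by rewrite rpredDr ?dvdz_mulr.
have d1 := prime_ndvdz_neq0 pd1.
have e1 : (1 + x) * d%:~R = (d + p%:Z * m)%:~R.
  by rewrite mulrDl mul1r e rmorphD rmorphM.
have x1 : 1 + x != 0.
  by apply: contraNneq d1 => h; rewrite -e1 h mul0r.
split=> //; exists d, (d + p%:Z * m); split=> //.
by rewrite -e1 mulKf // mul1r.
Qed.

Lemma local_dvd1_1 : ~ local_dvd 1 1.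
Proof.
move=> h; have [/eqP[]] := local_dvd_unit (local_dvdN h).
by rewrite subrr.
Qed.

Lemma local_dvd_cancel k (n : nat) x : ~~ (p %| n)%N ->
  local_dvd k (n%:R * x) -> local_dvd k x.
Proof.
move=> pn [m [d [pd e]]]; exists m, (n%:Z * d); split.
  by rewrite prime_dvdzM negb_or pd andbT.
by rewrite -e rmorphM /= mulrCA mulrA.
Qed.

Lemma local_dvd_cancel_p k x : local_dvd k.+1 (p%:R * x) -> local_dvd k x.
Proof.
move=> [m [d [pd e]]]; exists m, d; split=> //.
have p0 : p%:R != 0 :> rat by rewrite pnatr_eq0 -lt0n prime_gt0.
by apply: (mulfI p0); rewrite mulrA e exprS mulrA.
Qed.

Lemma local_dvd_numq x : local_dvd 1 x -> (p%:Z %| numq x)%Z.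
Proof.
move=> [m [d [pd e]]].
have : numq x * d = p%:Z * (m * denq x).
  apply: (@intr_inj rat); rewrite !rmorphM /= numqE mulrAC e expr1; ring.
by move/(congr1 (fun z => (p%:Z %| z)%Z)); rewrite prime_dvdzM (negPf pd) orbF dvdz_mulr.
Qed.

Lemma local_dvd_denq x : local_dvd 1 x -> ~~ (p%:Z %| denq x)%Z.
Proof.
move/local_dvd_numq => pn; apply/negP => pd.
have := coprime_num_den x; rewrite /coprime => /eqP h.
have : (p %| gcdn `|numq x| `|denq x|)%N.
  by rewrite dvdn_gcd; move: pn pd; rewrite !dvdzE => -> ->.
by rewrite h dvdn1; case: eqP p_pr => // ->.
Qed.

(** The exponent is the valuation of the numerator, the denominator being prime to [p]. *)
Lemma local_dvd_exact x : local_dvd 1 x -> x != 0 ->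
  exists k, [/\ (0 < k)%N, local_dvd k x & ~ local_dvd k.+1 x].
Proof.
move=> x1 x0; pose n := `|numq x|%N.
have n0 : (0 < n)%N by rewrite absz_gt0 numq_eq0.
have pd := local_dvd_denq x1.
exists (logn p n); split.
- by rewrite logn_gt0 mem_primes p_pr n0; move: (local_dvd_numq x1); rewrite dvdzE.
- have /dvdzP[m mE] : ((p ^ logn p n)%N%:Z %| numq x)%Z by rewrite dvdzE pfactor_dvdnn.
  exists m, (denq x); split=> //.
  by rewrite -numqE mE rmorphM mulrC /= -[_%:~R]pmulrn natrX.
move=> [m [d [pd' e]]].
have : numq x * d = (p ^ (logn p n).+1)%N%:Z * (m * denq x).
  by apply: (@intr_inj rat); rewrite !rmorphM /= numqE mulrAC e -[(p ^ _)%N%:~R]pmulrn natrX; ring.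
move=> /(congr1 absz); rewrite !abszM absz_nat => h.
have : (p ^ (logn p n).+1 %| n * `|d|)%N by rewrite h dvdn_mulr.
rewrite Gauss_dvdl ?coprimeXl ?prime_coprime //.
by rewrite pfactor_dvdn // ltnn.
Qed.

Lemma local_dvd_sqr x : local_dvd 1 (x ^+ 2) -> local_dvd 1 x.
Proof.
move=> [m [d [pd e]]].
have : numq x * numq x * d = p%:Z * (m * (denq x * denq x)).
  apply: (@intr_inj rat); rewrite !rmorphM /= numqE.
  by rewrite mulrACA -expr2 mulrAC e expr1; ring.
move=> h; have : (p%:Z %| numq x * numq x * d)%Z by rewrite h dvdz_mulr.
rewrite !prime_dvdzM (negPf pd) orbF orbb => pn.
have /dvdzP[n nE] := pn.
exists n, (denq x); split; last by rewrite -numqE nE rmorphM mulrC.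
apply/negP => pd'; have := coprime_num_den x; rewrite /coprime => /eqP co.
have : (p %| gcdn `|numq x| `|denq x|)%N.
  by rewrite dvdn_gcd; move: pn pd'; rewrite !dvdzE => -> ->.
by rewrite co dvdn1; case: eqP p_pr => // ->.
Qed.
End LocalDivisibility.

(** * Estimates in the formal group *)

Section FormalGroup.
Variables (p : nat) (A B : rat).
Hypotheses (p_pr : prime p) (iA : local_dvd p 0 A) (iB : local_dvd p 0 B).
Local Notation ldvd := (local_dvd p).

Lemma local_dvdMW n j k x y : (n <= j + k)%N -> ldvd j x -> ldvd k y -> ldvd n (x * y).
Proof. by move=> njk hx hy; apply: local_dvdW njk (local_dvdM p_pr hx hy). Qed.

(* In the coordinates [t = x / y], [s = 1 / y] at infinity the curve is
   [s = t^3 + A t^2 s + B t s^2] and the line [y = l x + c] becomes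
   [s = mu t + nu] with [mu = - l / c], [nu = 1 / c]. *)
Lemma third_point_slope x1 y1 x2 y2 x3 y3 l c :
  third_point A B x1 y1 x2 y2 x3 y3 l c -> y1 != 0 -> y2 != 0 -> c != 0 ->
  let t1 := x1 / y1 in let t2 := x2 / y2 in let s1 := y1^-1 in let s2 := y2^-1 in
  - l / c * (1 - (A * t1 ^+ 2 + B * t1 * (s1 + s2))) =
  t1 ^+ 2 + t1 * t2 + t2 ^+ 2 + A * s2 * (t1 + t2) + B * s2 ^+ 2.
Proof.
move=> [[y1E y2E _] [h1 h2 h3]] y10 y20 c0 /=.
(* The claim with denominators cleared. Once the line equations and the first two Vieta relations
   eliminate [y1], [y2], [A], [B], it is a multiple of the third relation. *)
have F0 : l * (y1 ^+ 2 * y2 ^+ 2 - A * x1 ^+ 2 * y2 ^+ 2 - B * x1 * (y2 ^+ 2 + y1 * y2)) +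
  c * (x1 ^+ 2 * y2 ^+ 2 + x1 * x2 * y1 * y2 + x2 ^+ 2 * y1 ^+ 2 +
       A * (x1 * y1 * y2 + x2 * y1 ^+ 2) + B * y1 ^+ 2) = 0.
  have -> : A = l ^+ 2 - (x1 + x2 + x3) by linear_combination h1.
  have -> : B = x1 * x2 + x1 * x3 + x2 * x3 + 2 * l * c.
    linear_combination (eqM (- 1) h2).
  rewrite y1E y2E; linear_combination (eqM (- (3 * l * c ^+ 2 + 3 * l ^+ 2 * c * x1
    + 3 * l ^+ 2 * c * x2 + l ^+ 3 * x1 * x2 + l ^+ 3 * x2 ^+ 2 + l ^+ 3 * x1 ^+ 2)) h3).
apply/eqP; rewrite -subr_eq0.
have hc : c * y1 ^+ 2 * y2 ^+ 2 != 0 by rewrite !mulf_neq0 // expf_neq0.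
rewrite -(mulIr_eq0 _ (mulIf hc)) -oppr_eq0 -[X in _ == X]F0; apply/eqP.
by field; rewrite y10 y20 c0.
Qed.

(** Substituting s = mu t + nu in the curve gives a cubic in t with leading coefficient 1 + A mu + B
    mu^2, a unit, and roots t1, t2, - t3. As mu lies in p^(2k) and nu in p^(3k), so does the sum of
    the roots lie in p^(3k): addition is t1 + t2 up to p^(3k). *)
Lemma third_point_formal k x1 y1 x2 y2 x3 y3 l c : (0 < k)%N ->
  third_point A B x1 y1 x2 y2 x3 y3 l c -> y1 != 0 -> y2 != 0 ->
  ldvd k (x1 / y1) -> ldvd k (x2 / y2) ->
  ldvd (3 * k) y1^-1 -> ldvd (3 * k) y2^-1 ->
  [/\ y3 != 0, ldvd (3 * k) (x3 / y3 - x1 / y1 - x2 / y2) & ldvd (3 * k) y3^-1].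
Proof.
move=> k0 tp y10 y20 t1k t2k s1k s2k.
have slope := third_point_slope tp y10 y20.
case: tp => [[y1E y2E y3E] [h1 h2 h3]].
have small : ldvd 1 (A * (x1 / y1) ^+ 2 + B * (x1 / y1) * (y1^-1 + y2^-1)).
  apply: local_dvdD => //.
    apply: (@local_dvdMW _ 0 1) => //.
    by apply: (@local_dvdMW _ k k) => //; lia.
  apply: (@local_dvdMW _ k (3 * k)); first by lia.
    exact: (@local_dvdMW _ 0 k).
  exact: local_dvdD.
(* On a line through (0, 0) the third point has [x3 = 0], and then the quantity in [small] equals 1,
   which [p] does not divide. *)
have c0 : c != 0.
  apply/eqP => c0; apply: (@local_dvd1_1 p).
  rewrite c0 !addr0 in y1E y2E.
  have /norP[l0 x10] : ~~ ((l == 0) || (x1 == 0)) by rewrite -mulf_eq0 -y1E.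
  have /norP[_ x20] : ~~ ((l == 0) || (x2 == 0)) by rewrite -mulf_eq0 -y2E.
  have x30 : x3 = 0.
    move/eqP: h3; rewrite c0 expr0n /= !mulf_eq0 (negPf x10) (negPf x20) /=.
    by move/eqP.
  have -> : 1 = A * (x1 / y1) ^+ 2 + B * (x1 / y1) * (y1^-1 + y2^-1).
    have -> : B = x1 * x2 by move: h2; rewrite c0 x30 => h2; linear_combination (eqM (- 1) h2).
    have -> : A = l ^+ 2 - (x1 + x2) by move: h1; rewrite x30 => h1; linear_combination h1.
    by rewrite y1E y2E; field; rewrite l0 x10 x20.
  by [].
have {slope} slope := slope c0.
have [D0 iD] := local_dvd_unit (local_dvdN small).
set mu := - l / c in slope.
have mu2k : ldvd (2 * k) mu.
  have -> : mu = (mu * (1 - (A * (x1 / y1) ^+ 2 + B * (x1 / y1) * (y1^-1 + y2^-1)))) *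
     (1 - (A * (x1 / y1) ^+ 2 + B * (x1 / y1) * (y1^-1 + y2^-1)))^-1 by rewrite mulfK.
  rewrite slope; apply: (@local_dvdMW _ (2 * k) 0) => //; first by lia.
  have tt x y : ldvd k x -> ldvd k y -> ldvd (2 * k) (x * y).
    by move=> hx hy; apply: (@local_dvdMW _ k k) => //; lia.
  apply: local_dvdD => //; last first.
    apply: (@local_dvdMW _ 0 (2 * k)) => //.
    by apply: (@local_dvdMW _ (3 * k) (3 * k)) => //; lia.
  apply: local_dvdD => //; last first.
    apply: (@local_dvdMW _ (3 * k) 0); first by lia.
      exact: (@local_dvdMW _ 0 (3 * k)).
    by apply: (@local_dvdW _ 0 k) => //; apply: local_dvdD.
  by apply: local_dvdD => //; [apply: local_dvdD => //|]; rewrite ?expr2; apply: tt.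
have nu3k : ldvd (3 * k) c^-1.
  have -> : c^-1 = y1^-1 - mu * (x1 / y1).
    transitivity (y1 / (c * y1)); first by field; rewrite c0 y10.
    by rewrite {1}y1E /mu; field; rewrite c0 y10.
  by apply: local_dvdB => //; apply: (@local_dvdMW _ (2 * k) k) => //; lia.
have small2 : ldvd 1 (A * mu + B * mu ^+ 2).
  apply: local_dvdD => //; apply: (@local_dvdMW _ 0 1) => //.
    by apply: local_dvdW mu2k; lia.
  by apply: (@local_dvdMW _ (2 * k) (2 * k)) => //; lia.
have [U0 iU] := local_dvd_unit small2.
have UE : y1 * y2 * y3 = - (c ^+ 3 * (1 + (A * mu + B * mu ^+ 2))).
  have -> : c ^+ 3 * (1 + (A * mu + B * mu ^+ 2)) = c ^+ 3 - A * l * c ^+ 2 + B * l ^+ 2 * c.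
    by rewrite /mu; field.
  rewrite y1E y2E y3E.
  linear_combination (eqM (- 1)
    (eqD (eqD (eqM (l * c ^+ 2) h1) (eqM (l ^+ 2 * c) h2)) (eqM (l ^+ 3) h3))).
have y30 : y3 != 0.
  have : y1 * y2 * y3 != 0 by rewrite UE oppr_eq0 mulf_neq0 // expf_neq0.
  by rewrite mulf_eq0 => /norP[].
(* The sum of the roots of the cubic in t, with nu = 1 / c. *)
have tE : x3 / y3 - x1 / y1 - x2 / y2 =
   c^-1 * (A + 2 * B * mu) / (1 + (A * mu + B * mu ^+ 2)).
  have num : x3 * y1 * y2 - x1 * y2 * y3 - x2 * y1 * y3 = 2 * l * c * B - A * c ^+ 2.
    rewrite y1E y2E y3E; linear_combination
      (eqD (eqD (eqM (c ^+ 2) h1) (eqM (2 * l * c) h2)) (eqM (3 * l ^+ 2) h3)).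
  transitivity ((x3 * y1 * y2 - x1 * y2 * y3 - x2 * y1 * y3) / (y1 * y2 * y3)).
    by field; rewrite y10 y20 y30.
  rewrite num UE; move: U0; move: (1 + _) => U U0.
  by rewrite /mu; field; rewrite c0 U0.
have t3 : ldvd (3 * k) (x3 / y3 - x1 / y1 - x2 / y2).
  rewrite tE; apply: (@local_dvdMW _ (3 * k) 0) => //; first by lia.
  apply: (@local_dvdMW _ (3 * k) 0) => //; first by lia.
  apply: local_dvdD => //; apply: (@local_dvdMW _ 0 0) => //; last exact: local_dvdW mu2k.
  by apply: (@local_dvdMW _ 0 0) => //; apply: (local_dvd_int p_pr 2).
split=> //.
have t3k : ldvd k (x3 / y3).
  have -> : x3 / y3 = (x3 / y3 - x1 / y1 - x2 / y2) + x1 / y1 + x2 / y2 by ring.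
  apply: local_dvdD => //; apply: local_dvdD => //; apply: local_dvdW t3; lia.
have -> : y3^-1 = - c^-1 + mu * (x3 / y3).
  transitivity (- (y3 + l * x3) / (c * y3)).
    have -> : y3 + l * x3 = - c by rewrite y3E; ring.
    by field; rewrite c0 y30.
  by rewrite /mu; field; rewrite c0 y30.
apply: local_dvdD => //; first exact: local_dvdN.
by apply: (@local_dvdMW _ (2 * k) k) => //; lia.
Qed.
End FormalGroup.

(** * Torsion and the kernel of reduction *)

Section KernelOfReduction.
Variables (p : nat) (A B : rat).
Hypotheses (p_pr : prime p) (iA : local_dvd p 0 A) (iB : local_dvd p 0 B).
Hypothesis ns : disc A B != 0.
Local Notation ldvd := (local_dvd p).

Definition formal_param (P : point) : rat := if P is Some (x, y) then x / y else 0.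

(** The k-th step of the filtration of the kernel of reduction modulo [p], in the coordinates t = x
    / y and s = 1 / y. *)
Definition near_origin (k : nat) (P : point) : Prop :=
  if P is Some (x, y) then [/\ y != 0, ldvd k (x / y) & ldvd (3 * k) y^-1] else True.

Lemma near_originW k P : near_origin k P -> ldvd k (formal_param P).
Proof. by case: P => [[x y] []|_] //=; apply: (local_dvd0 p_pr). Qed.

Lemma near_origin_add k P Q : (0 < k)%N -> on_curve A B P -> on_curve A B Q ->
  near_origin k P -> near_origin k Q ->
  near_origin k (ec_add A B P Q) /\
  ldvd (3 * k) (formal_param (ec_add A B P Q) - formal_param P - formal_param Q).
Proof.
move=> k0; case: P => [[x1 y1]|] onP; last first.
  by move=> _ _ nQ; rewrite /= subr0 subrr; split=> //; apply: (local_dvd0 p_pr).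
case: Q => [[x2 y2]|] onQ; last first.
  by move=> nP _; rewrite /= subrr subr0; split=> //; apply: (local_dvd0 p_pr).
move=> [y10 t1 s1] [y20 t2 s2].
case E: (ec_add A B (Some (x1, y1)) (Some (x2, y2))) => [[x3 y3]|]; last first.
  have /ec_add_eq_None [-> ->] := E; split=> //=.
  by rewrite invrN mulrN sub0r opprK subrr; apply: (local_dvd0 p_pr).
have /(ec_add_SomeP _ _ ns onP onQ) [l [c tp]] := E.
have [y30 d3 s3] := third_point_formal p_pr iA iB k0 tp y10 y20 t1 t2 s1 s2.
split=> //; split=> //.
have -> : x3 / y3 = (x3 / y3 - x1 / y1 - x2 / y2) + x1 / y1 + x2 / y2 by ring.
by do 2![apply: local_dvdD => //]; apply: local_dvdW d3; lia.
Qed.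

(** The curve equation at infinity reads s (1 - A t^2 - B t s) = t^3, and the second factor is a
    unit. *)
Lemma local_dvd_inv_y k x y : on_curve A B (Some (x, y)) -> y != 0 ->
  ldvd 1 (x / y) -> ldvd 1 y^-1 -> ldvd k (x / y) -> ldvd (3 * k) y^-1.
Proof.
move=> /eqP e y0 t1 s1 tk.
have small : ldvd 1 (A * (x / y) ^+ 2 + B * (x / y) * y^-1).
  apply: local_dvdD => //.
    by apply: (@local_dvdMW p p_pr _ 0 1) => //; apply: (@local_dvdMW p p_pr _ 1 1).
  apply: (@local_dvdMW p p_pr _ 1 1) => //; exact: (@local_dvdMW p p_pr _ 0 1).
have [U0 iU] := local_dvd_unit (local_dvdN small).
have -> : y^-1 = (x / y) ^+ 3 * (1 - (A * (x / y) ^+ 2 + B * (x / y) * y^-1))^-1.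
  apply: (mulIf U0); rewrite mulfVK //.
  transitivity ((y ^+ 2 - A * x ^+ 2 - B * x) / y ^+ 3); first by field.
  by rewrite e; field.
apply: (@local_dvdMW p p_pr _ (3 * k) 0); [lia| |by []].
rewrite exprS; apply: (@local_dvdMW p p_pr _ k (2 * k)); [lia|by []|].
by rewrite expr2; apply: (@local_dvdMW p p_pr _ k k) => //; lia.
Qed.

Lemma near_origin_mulrn k (P : ecgroup ns) n : (0 < k)%N -> near_origin k (val P) ->
  near_origin k (val (P *+ n)) /\
  ldvd (3 * k) (formal_param (val (P *+ n)) - n%:R * formal_param (val P)).
Proof.
move=> k0 nP; elim: n => [|n [near_n tn]].
  by rewrite mul0r subr0; split=> //; apply: (local_dvd0 p_pr).
rewrite mulrS val_ecD.
have [near_n1 tn1] := near_origin_add k0 (valP P) (valP (P *+ n)) nP near_n.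
split=> //; have := local_dvdD p_pr tn1 tn; congr (ldvd _ _).
by rewrite -[n.+1]addn1 natrD; ring.
Qed.

(** Let k be the exact valuation of t(P). If [p] does not divide [n], then n t(P) lies in p^(3k),
    and so does t(P). Otherwise p P is killed by n / p, so p P = 0 by induction, and t(P) lies in
    p^(3k - 1). Both contradict the choice of k. *)
Lemma near_origin_torsion_free (P : ecgroup ns) n : (0 < n)%N -> near_origin 1 (val P) ->
  P *+ n = 0 -> P = 0.
Proof.
elim/ltn_ind: n P => n IH P n0 nP Pn; case: (eqVneq P 0) => // P0; exfalso.
have t0 : formal_param (val P) != 0.
  have := valP P; have : val P != None by apply: contra P0 => /eqP h; apply/eqP/val_inj.
  case: (val P) nP => [[x y]|] //= [y0 _ s3] _ /eqP e.
  rewrite mulf_neq0 ?invr_neq0 //; apply: contraNneq y0 => x0.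
  by move/eqP: e; rewrite x0 !expr0n /= !mulr0 !addr0 expf_eq0.
have [k [k0 tk tk1]] := local_dvd_exact p_pr (near_originW nP) t0.
have {nP} nP : near_origin k (val P).
  move: (valP P) nP tk; case: (val P) => [[x y]|] //= onP [y0 t1 s3] tk; split=> //.
  by apply: local_dvd_inv_y onP y0 t1 _ tk; apply: local_dvdW s3.
have mulE m := near_origin_mulrn m k0 nP.
case: (boolP (p %| n)%N) => [/dvdnP[m nE]|pn]; last first.
  have [_] := mulE n; rewrite Pn val_ec0 sub0r => /local_dvdN; rewrite opprK.
  move/(local_dvd_cancel p_pr pn) => h; apply: tk1; apply: local_dvdW h; lia.
have p1 := prime_gt1 p_pr.
have [near_p tp] := mulE p.
have m0 : (0 < m)%N by move: n0; rewrite nE muln_gt0 => /andP[].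
have Pp : P *+ p = 0.
  apply: (IH m) => //; first by rewrite nE ltn_Pmulr.
    move: near_p; case: (val _) => [[x y]|] //= [h1 h2 h3]; split=> //.
      exact: local_dvdW h2.
    by apply: local_dvdW h3; lia.
  by rewrite -mulrnA mulnC -nE.
move: tp; rewrite Pp val_ec0 sub0r => /local_dvdN; rewrite opprK => h.
apply: tk1; apply: (@local_dvd_cancel_p p p_pr); apply: local_dvdW h; lia.
Qed.

(** If [p] divides the denominator of [x], then 1 / x lies in p Z_(p), and t^2 is 1 / x times a
    unit. So t, and with it s = t / x, lies in p Z_(p): the point is in the kernel of reduction,
    which has no torsion. *)
Lemma torsion_denq (P : ecgroup ns) x y n : val P = Some (x, y) ->
  (0 < n)%N -> P *+ n = 0 -> ~~ (p%:Z %| denq x)%Z.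
Proof.
move=> PE n0 Pn; apply/negP => pd; have onP := valP P; rewrite PE in onP.
suff nP : near_origin 1 (val P).
  by have P0 := near_origin_torsion_free n0 nP Pn; rewrite P0 in PE.
rewrite PE.
have x0 : x != 0.
  by apply: contraTneq pd => ->; rewrite (_ : denq 0 = 1) // dvdz1 absz_nat; case: eqP p_pr => // ->.
have z1 : ldvd 1 x^-1.
  have /dvdzP[m mE] := pd; exists m, (numq x); split.
    apply/negP => pn; have := coprime_num_den x; rewrite /coprime => /eqP co.
    have : (p %| gcdn `|numq x| `|denq x|)%N.
      by rewrite dvdn_gcd; move: pn pd; rewrite !dvdzE => -> ->.
    by rewrite co dvdn1; case: eqP p_pr => // ->.
  by rewrite numqE mulKf // mE rmorphM /= mulrC expr1.
have small : ldvd 1 (A * x^-1 + B * x^-1 ^+ 2).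
  apply: local_dvdD => //; first exact: (@local_dvdMW p p_pr _ 0 1).
  by apply: (@local_dvdMW p p_pr _ 0 1) => //; apply: (@local_dvdMW p p_pr _ 1 1).
have [U0 iU] := local_dvd_unit small.
have /eqP e := onP.
have yE : y ^+ 2 = x ^+ 3 * (1 + (A * x^-1 + B * x^-1 ^+ 2)) by rewrite e; field.
have y0 : y != 0.
  have : y ^+ 2 != 0 by rewrite yE mulf_neq0 // expf_neq0.
  by rewrite expf_eq0.
have t1 : ldvd 1 (x / y).
  apply: (local_dvd_sqr p_pr); rewrite exprMn exprVn yE.
  have -> : x ^+ 2 / (x ^+ 3 * (1 + (A * x^-1 + B * x^-1 ^+ 2))) =
     x^-1 * (1 + (A * x^-1 + B * x^-1 ^+ 2))^-1.
    by move: U0; move: (1 + _) => U U0; field; rewrite U0 x0.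
  exact: (@local_dvdMW p p_pr _ 1 0).
have s1 : ldvd 1 y^-1.
  have -> : y^-1 = x / y * x^-1 by field; rewrite x0 y0.
  exact: (@local_dvdMW p p_pr _ 1 1).
split=> //; exact: (@local_dvd_inv_y 1 _ _ onP y0 t1 s1 t1).
Qed.
End KernelOfReduction.

Lemma torsion_integral (A B : rat) (a b : int) (ns : disc A B != 0) (P : ecgroup ns) x y n :
  A = a%:~R -> B = b%:~R -> val P = Some (x, y) -> (0 < n)%N -> P *+ n = 0 ->
  x = (numq x)%:~R.
Proof.
move=> AE BE PE n0 Pn; rewrite -[LHS]divq_num_den.
suff -> : denq x = 1 by rewrite divr1.
apply/eqP; rewrite -[denq x]gez0_abs ?ltW ?denq_gt0 // eqz_nat; apply: contraT => d1.
have /pdivP[p p_pr pd] : (1 < `|denq x|)%N.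
  by rewrite ltn_neqAle eq_sym d1 absz_gt0 denq_neq0.
have iA : local_dvd p 0 A by rewrite AE; apply: local_dvd_int.
have iB : local_dvd p 0 B by rewrite BE; apply: local_dvd_int.
by have := torsion_denq p_pr iA iB PE n0 Pn; rewrite dvdzE pd.
Qed.

(** * Halving rational points *)

Lemma ec_double_x M N x y x' y' : on_curve (M + N) (M * N) (Some (x, y)) ->
  ec_add (M + N) (M * N) (Some (x, y)) (Some (x, y)) = Some (x', y') ->
  y != 0 /\ [/\ x' = ((x ^+ 2 - M * N) / (2 * y)) ^+ 2,
   x' + M = ((x ^+ 2 + 2 * M * x + M * N) / (2 * y)) ^+ 2
   & x' + N = ((x ^+ 2 + 2 * N * x + M * N) / (2 * y)) ^+ 2].
Proof.
move=> /eqP e; rewrite /ec_add eqxx /=; case: ifP => // /negbT y0 [<- _].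
have {}y0 : y != 0 by apply: contra y0 => /eqP ->; rewrite oppr0.
have yy : (2 * y) ^+ 2 != 0 by rewrite expf_neq0 // mulf_neq0.
(* One formula for all three coordinates, with [K] equal to 0, [M] and [N]. *)
have slope K : ((3 * x ^+ 2 + 2 * (M + N) * x + M * N) / (2 * y)) ^+ 2
    - (M + N) - x - x + K =
   ((3 * x ^+ 2 + 2 * (M + N) * x + M * N) ^+ 2
     - 4 * (M + N + 2 * x - K) * (x ^+ 3 + (M + N) * x ^+ 2 + M * N * x))
     / (2 * y) ^+ 2.
  by rewrite -e; field.
split=> //; split; [rewrite -[LHS]addr0| |]; rewrite slope [RHS]expr_div_n;
  congr (_ / _); ring.
Qed.

Lemma sqr_rat_int (r : rat) (z : int) : r ^+ 2 = z%:~R -> exists n : nat, r ^+ 2 = n%:R ^+ 2.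
Proof.
move=> e; have : numq r * numq r = z * (denq r * denq r).
  by apply: (@intr_inj rat); rewrite !rmorphM /= -e numqE; ring.
move/(congr1 absz); rewrite !abszM !mulnn => h.
have : (`|denq r| ^ 2 %| `|numq r| ^ 2)%N by rewrite h dvdn_mull.
rewrite dvdn_pexp2r // => hd.
have : coprime `|numq r| `|denq r| := coprime_num_den r.
rewrite /coprime gcdnC (gcdn_idPl hd) => /eqP d1.
exists `|numq r|%N; rewrite -[r in LHS]divq_num_den.
rewrite -[denq r]gez0_abs ?ltW ?denq_gt0 // d1 divr1.
by rewrite natr_absz intr_norm real_normK ?num_real.
Qed.

Section Halving.
Variables u v : nat.
Hypotheses (uv : coprime u v) (u0 : (0 < u)%N) (v0 : (0 < v)%N).
Local Notation M := (u%:R ^+ 4 : rat).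
Local Notation N := (v%:R ^+ 4 : rat).

Definition square_triple (x : rat) (X Y Z : nat) : Prop :=
  [/\ x = X%:R ^+ 2, x + M = Y%:R ^+ 2 & x + N = Z%:R ^+ 2].

(** Inverts the duplication formulas: [al] = X1 Y1 / Z1, [ga] = X1 Z1 / Y1 and [et] = Y1 Z1 / X1.
    The formulas fix [Y] and [Z], which are nonnegative, but leave the sign of [X] open; hence the
    two final alternatives. *)
Lemma halving_factors x y x' X1 Y1 Z1 X Y Z :
  y ^+ 2 = x * (x + M) * (x + N) -> y != 0 ->
  x' = ((x ^+ 2 - M * N) / (2 * y)) ^+ 2 ->
  x' + M = ((x ^+ 2 + 2 * M * x + M * N) / (2 * y)) ^+ 2 ->
  x' + N = ((x ^+ 2 + 2 * N * x + M * N) / (2 * y)) ^+ 2 ->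
  square_triple x X1 Y1 Z1 -> square_triple x' X Y Z ->
  exists al be ga de et : nat,
    [/\ (al * be = u ^ 4)%N, (ga * de = v ^ 4)%N, (al + de = et)%N & (be + ga = et)%N] /\
    [/\ (al * ga = X1 ^ 2)%N, (al * et = Y1 ^ 2)%N & (ga * et = Z1 ^ 2)%N] /\
    ([/\ al = Y + X, be = Y - X, ga = Z + X & de = Z - X] \/
     [/\ al = Y - X, be = Y + X, ga = Z - X & de = Z + X])%N.
Proof.
move=> yE y0 d1 d2 d3 [xX xY xZ] [xX' xY' xZ'].
have natinj (m n : nat) : m%:R = n%:R :> rat -> m = n by move/eqP; rewrite eqr_nat => /eqP.
have ME : M = Y1%:R ^+ 2 - X1%:R ^+ 2 by rewrite -xY -xX; ring.
have NE : N = Z1%:R ^+ 2 - X1%:R ^+ 2 by rewrite -xZ -xX; ring.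
have yE' : y ^+ 2 = (X1%:R * Y1%:R * Z1%:R) ^+ 2 by rewrite yE xZ xY xX; ring.
have : X1%:R * Y1%:R * Z1%:R != 0 :> rat.
  by apply: contraNneq y0 => h; move/eqP: yE'; rewrite h expr0n /= expf_eq0.
rewrite !mulf_eq0 => /norP[/norP[X10 Y10] Z10].
have yy : (2 * y) ^+ 2 = (2 * (X1%:R * Y1%:R * Z1%:R)) ^+ 2.
  by transitivity (4 * y ^+ 2); [ring | rewrite yE'; ring].
have sqE q : (q / (2 * y)) ^+ 2 = (q / (2 * (X1%:R * Y1%:R * Z1%:R))) ^+ 2.
  by rewrite [LHS]expr_div_n [RHS]expr_div_n yy.
have YE : Y%:R = (X1%:R ^+ 2 * Y1%:R ^+ 2 + M * Z1%:R ^+ 2) / (2 * (X1%:R * Y1%:R * Z1%:R)).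
  apply/eqP; rewrite -(@eqrXn2 _ 2) ?ler0n ?divr_ge0 ?addr_ge0 ?mulr_ge0 ?exprn_ge0 ?ler0n //.
  rewrite -xY' d2 sqE; apply/eqP; congr ((_ / _) ^+ 2); rewrite -xY -xZ xX; ring.
have ZE : Z%:R = (X1%:R ^+ 2 * Z1%:R ^+ 2 + N * Y1%:R ^+ 2) / (2 * (X1%:R * Y1%:R * Z1%:R)).
  apply/eqP; rewrite -(@eqrXn2 _ 2) ?ler0n ?divr_ge0 ?addr_ge0 ?mulr_ge0 ?exprn_ge0 ?ler0n //.
  rewrite -xZ' d3 sqE; apply/eqP; congr ((_ / _) ^+ 2); rewrite -xY -xZ xX; ring.
have : X%:R ^+ 2 = ((X1%:R ^+ 2 * Y1%:R ^+ 2 - M * Z1%:R ^+ 2) / (2 * (X1%:R * Y1%:R * Z1%:R))) ^+ 2.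
  rewrite -xX' d1 sqE; congr ((_ / _) ^+ 2); rewrite -xY -xZ xX; ring.
have XY : (X <= Y)%N.
  by rewrite -(ler_nat rat) -(@ler_pXn2r _ 2) ?nnegrE ?ler0n // -xX' -xY' lerDl exprn_ge0 ?ler0n.
have XZ : (X <= Z)%N.
  by rewrite -(ler_nat rat) -(@ler_pXn2r _ 2) ?nnegrE ?ler0n // -xX' -xZ' lerDl exprn_ge0 ?ler0n.
have relations (al be ga de et : nat) :
    al%:R = X1%:R * Y1%:R / Z1%:R :> rat -> be%:R = M * Z1%:R / (X1%:R * Y1%:R) ->
    ga%:R = X1%:R * Z1%:R / Y1%:R :> rat -> de%:R = N * Y1%:R / (X1%:R * Z1%:R) ->
    et%:R = Y1%:R * Z1%:R / X1%:R :> rat ->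
  [/\ (al * be = u ^ 4)%N, (ga * de = v ^ 4)%N, (al + de = et)%N & (be + ga = et)%N] /\
  [/\ (al * ga = X1 ^ 2)%N, (al * et = Y1 ^ 2)%N & (ga * et = Z1 ^ 2)%N].
  move=> alE beE gaE deE etE.
  split; split; apply: natinj; rewrite ?natrX ?natrM ?natrD ?alE ?beE ?gaE ?deE ?etE ?ME ?NE;
    by field; rewrite ?X10 ?Y10 ?Z10.
move/eqP; rewrite eqf_sqr => /orP[] /eqP XE.
- exists (Y + X)%N, (Y - X)%N, (Z + X)%N, (Z - X)%N, (Y + Z)%N.
  have [|||||r1 r2] := relations (Y + X)%N (Y - X)%N (Z + X)%N (Z - X)%N (Y + Z)%N;
    last (by split; [|split=> //; left]);
    rewrite ?natrB ?natrD // ?YE ?ZE ?XE ?ME ?NE; by field; rewrite ?X10 ?Y10 ?Z10.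
- exists (Y - X)%N, (Y + X)%N, (Z - X)%N, (Z + X)%N, (Y + Z)%N.
  have [|||||r1 r2] := relations (Y - X)%N (Y + X)%N (Z - X)%N (Z + X)%N (Y + Z)%N;
    last (by split; [|split=> //; right]);
    rewrite ?natrB ?natrD // ?YE ?ZE ?XE ?ME ?NE; by field; rewrite ?X10 ?Y10 ?Z10.
Qed.
End Halving.

(** * The torsion is killed by eight *)

Section TorsionExponent.
Variables u v : nat.
Hypotheses (uv : coprime u v) (u0 : (0 < u)%N) (v0 : (0 < v)%N).
Local Notation M := (u%:R ^+ 4 : rat).
Local Notation N := (v%:R ^+ 4 : rat).
Hypothesis ns : disc (M + N) (M * N) != 0.
Implicit Types P Q : ecgroup ns.

(** Duplication makes x', x' + M and x' + N rational squares; integrality of torsion makes their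
    roots integers. *)
Lemma double_square_triple Q n : (0 < n)%N -> Q *+ n = 0 -> Q *+ 2 != 0 ->
  exists x y x' y' X Y Z,
  [/\ val Q = Some (x, y), val (Q *+ 2) = Some (x', y'), square_triple u v x' X Y Z
    & y ^+ 2 = x * (x + M) * (x + N)] /\
  [/\ y != 0, x' = ((x ^+ 2 - M * N) / (2 * y)) ^+ 2,
   x' + M = ((x ^+ 2 + 2 * M * x + M * N) / (2 * y)) ^+ 2
   & x' + N = ((x ^+ 2 + 2 * N * x + M * N) / (2 * y)) ^+ 2].
Proof.
move=> n0 Qn Q2.
case QE : (val Q) => [[x y]|]; last first.
  by case/negP: Q2; apply/eqP/val_inj; rewrite mulr2n val_ecD QE.
case Q2E : (val (Q *+ 2)) => [[x' y']|]; last first.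
  by case/negP: Q2; apply/eqP/val_inj.
have onQ := valP Q; rewrite QE in onQ.
have dbl : ec_add (M + N) (M * N) (Some (x, y)) (Some (x, y)) = Some (x', y').
  by rewrite -Q2E mulr2n val_ecD QE.
have [y0 [d1 d2 d3]] := ec_double_x onQ dbl.
have x'E : x' = (numq x')%:~R.
  apply: (@torsion_integral _ _ (u%:Z ^+ 4 + v%:Z ^+ 4) (u%:Z ^+ 4 * v%:Z ^+ 4) ns (Q *+ 2) x' y' n) => //.
  - by rewrite rmorphD !rmorphXn.
  - by rewrite rmorphM !rmorphXn.
  - by rewrite mulrnAC Qn mul0rn.
have [X xX] := sqr_rat_int (etrans (esym d1) x'E).
have [|Y xY] := @sqr_rat_int _ (numq x' + u%:Z ^+ 4) (etrans (esym d2) _).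
  by rewrite rmorphD rmorphXn /= -x'E.
have [|Z xZ] := @sqr_rat_int _ (numq x' + v%:Z ^+ 4) (etrans (esym d3) _).
  by rewrite rmorphD rmorphXn /= -x'E.
exists x, y, x', y', X, Y, Z; split; split=> //.
  by split; rewrite -?xX -?xY -?xZ.
by move: onQ => /eqP ->; ring.
Qed.

Lemma torsion_mul8 Q n : (0 < n)%N -> Q *+ n = 0 -> Q *+ 8 = 0.
Proof.
move=> n0 Qn; apply/eqP; apply: contraT => Q8; exfalso.
have Q4n k : Q *+ k *+ n = 0 by rewrite mulrnAC Qn mul0rn.
have Q4 : Q *+ 2 *+ 2 != 0.
  by apply: contra Q8 => /eqP h; rewrite (mulrnA Q 4 2) (mulrnA Q 2 2) h mul0rn.
have Q2 : Q *+ 2 != 0 by apply: contra Q4 => /eqP ->; rewrite mul0rn.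
have [_ [_ [x2 [y2 [X2 [Y2 [Z2 [[_ E2 t2 _] _]]]]]]]] := double_square_triple n0 Qn Q2.
have := double_square_triple n0 (Q4n 2) Q4; rewrite E2.
move=> [_ [_ [x1 [y1 [X1 [Y1 [Z1 [[[<- <-] E1 t1 c2] [y20 d1 d2 d3]]]]]]]]].
have Q8' : Q *+ 2 *+ 2 *+ 2 != 0 by rewrite -!mulrnA.
have Q22n : Q *+ 2 *+ 2 *+ n = 0 by rewrite -[Q *+ 2 *+ 2]mulrnA.
have := double_square_triple n0 Q22n Q8'; rewrite E1.
move=> [_ [_ [x0 [y0 [X0 [Y0 [Z0 [[[<- <-] E0 t0 c1] [y10 e1 e2 e3]]]]]]]]].
(* Halving 4 Q to 2 Q shows that Y1 + X1, Y1 - X1, Z1 + X1 and Z1 - X1 are squares. *)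
have [al [be [ga [de [et [[r1 r2 r3 r4] [[r5 r6 r7] r8]]]]]]] :=
  halving_factors c2 y20 d1 d2 d3 t2 t1.
have [] := halving_squares uv u0 v0 r1 r2 r3 r4.
- by exists X2.
- by exists Y2.
move=> a [b [c [d [h [[aE bE cE dE hE] _]]]]].
(* Halving 8 Q to 4 Q supplies the factorizations of X1^2, Y1^2, Z1^2 that these squares
   contradict. *)
have [al' [be' [ga' [de' [et' [[s1 s2 s3 s4] [[s5 s6 s7] _]]]]]]] :=
  halving_factors c1 y10 e1 e2 e3 t1 t0.
apply: (no_integral_halving uv u0 v0 s1 s2 s3 s4 s5 s6 s7).
all: case: r8 => -[h1 h2 h3 h4]; rewrite -?h1 -?h2 -?h3 -?h4.
all: by rewrite ?aE ?bE ?cE ?dE; eexists.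
Qed.
End TorsionExponent.

(** * The torsion subgroup *)

Section TorsionGroup.
Variables (u v : nat) (w : rat).
Hypotheses (uv : coprime u v) (u0 : (0 < u)%N) (v0 : (0 < v)%N).
Local Notation U := (u%:R : rat).
Local Notation V := (v%:R : rat).
Hypotheses (w0 : 0 < w) (uvw : U ^+ 2 + V ^+ 2 = w ^+ 2).
Local Notation M := (U ^+ 4).
Local Notation N := (V ^+ 4).
Hypothesis ns : disc (M + N) (M * N) != 0.
Local Notation E := (ecgroup ns).
Local Notation ecadd := (ec_add (M + N) (M * N)).

Let U0 : 0 < U. Proof. by rewrite ltr0n. Qed.
Let V0 : 0 < V. Proof. by rewrite ltr0n. Qed.

(** A half of the point with x = U^2 V^2. There X = U V, Y = U w, Z = V w, and the half has
    coordinates (X + Y) (X + Z) and (X + Y) (X + Z) (Y + Z). *)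
Definition gen8 : rat * rat :=
  (U * V * (U + w) * (V + w), U * V * w * (U + V) * (U + w) * (V + w)).

Lemma on_gen8 : on_curve (M + N) (M * N) (Some gen8).
Proof.
by apply/eqP; have WE : w ^+ 2 = U ^+ 2 + V ^+ 2 by []; ring: WE.
Qed.

Lemma on_gen2 : on_curve (M + N) (M * N) (Some (- M, 0)).
Proof. by apply/eqP; ring. Qed.

Lemma ec_add_gen8 : ecadd (Some gen8) (Some gen8) =
  Some (U ^+ 2 * V ^+ 2, U ^+ 2 * V ^+ 2 * w ^+ 2).
Proof.
apply/(ec_add_SomeP _ _ ns on_gen8 on_gen8).
(* The tangent has slope X + Y + Z and intercept - X (X + Y) (X + Z). *)
exists (U * V + U * w + V * w), (- (U * V * (U * V + U * w) * (U * V + V * w))).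
have WE : w ^+ 2 = U ^+ 2 + V ^+ 2 by [].
split; split.
- ring.
- ring.
- ring.
- ring: WE.
- ring: WE.
- ring.
Qed.

Definition T8 : E := exist _ (Some gen8) on_gen8.
Definition T2 : E := exist _ (Some (- M, 0)) on_gen2.

Lemma val_T8_2 : val (T8 *+ 2) = Some (U ^+ 2 * V ^+ 2, U ^+ 2 * V ^+ 2 * w ^+ 2).
Proof. by rewrite mulr2n val_ecD ec_add_gen8. Qed.

Lemma val_T8_4 : val (T8 *+ 4) = Some (0, 0).
Proof.
have onP4 := valP (T8 *+ 2); rewrite val_T8_2 in onP4.
rewrite (mulrnA T8 2 2) mulr2n val_ecD val_T8_2.
apply/(ec_add_SomeP _ _ ns onP4 onP4); exists (w ^+ 2), 0.
have WE : w ^+ 2 = U ^+ 2 + V ^+ 2 by [].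
split; split; [ring|ring|ring|ring: WE|ring: WE|ring].
Qed.

Lemma T8_8 : T8 *+ 8 = 0.
Proof.
rewrite (mulrnA T8 4 2) mulr2n; apply: val_inj; rewrite val_ecD val_T8_4.
by apply/ec_add_eq_None; rewrite /= oppr0.
Qed.

Lemma T2_2 : T2 *+ 2 = 0.
Proof.
rewrite mulr2n; apply: val_inj; rewrite val_ecD.
by apply/ec_add_eq_None; rewrite /= oppr0.
Qed.

Lemma val_T2_T8_4 : val (T2 + T8 *+ 4) = Some (- N, 0).
Proof.
have onT := valP (T8 *+ 4); rewrite val_T8_4 in onT.
rewrite val_ecD val_T8_4; apply/(ec_add_SomeP _ _ ns on_gen2 onT).
by exists 0, 0; split; split; ring.
Qed.

Lemma order2_cases (P : E) : P *+ 2 = 0 ->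
  [\/ P = 0, P = T8 *+ 4, P = T2 | P = T2 + T8 *+ 4].
Proof.
move=> dP; case PE : (val P) => [[x y]|]; last by apply: Or41; apply: val_inj.
have /(congr1 val) := dP; rewrite mulr2n val_ecD PE => /ec_add_eq_None /= [yE].
have y0 : y = 0 by lra.
have := valP P; rewrite PE y0 => /eqP e.
have : x * ((x + M) * (x + N)) = 0 by linear_combination (esym e).
move/eqP; rewrite !mulf_eq0 !addr_eq0 => /or3P[] /eqP xE.
- by apply: Or42; apply: val_inj; rewrite PE xE y0 val_T8_4.
- by apply: Or43; apply: val_inj; rewrite PE xE y0.
- by apply: Or44; apply: val_inj; rewrite PE xE y0 val_T2_T8_4.
Qed.

(** A double has a square x-coordinate, whereas - M and - N are negative. *)
Lemma order2_double (Q : E) : Q *+ 2 *+ 2 = 0 -> Q *+ 2 = 0 \/ Q *+ 2 = T8 *+ 4.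
Proof.
have no_neg_square (r s : rat) : 0 < r -> - r ^+ 4 = s ^+ 2 -> False.
  move=> r0 e; have := sqr_ge0 s; rewrite -e oppr_ge0 leNgt exprn_gt0 //.
have dblx x : val (Q *+ 2) = Some (x, 0) -> exists s, x = s ^+ 2.
  rewrite mulr2n val_ecD; case QE : (val Q) => [[x1 y1]|] // h.
  have onQ := valP Q; rewrite QE in onQ.
  by have [_ [-> _ _]] := ec_double_x onQ h; eexists.
case/order2_cases => e; [by left|by right|exfalso|exfalso].
  have [s] := dblx (- M) (congr1 val e); exact: no_neg_square U0.
have [s] := dblx (- N) (etrans (congr1 val e) val_T2_T8_4); exact: no_neg_square V0.
Qed.

(** By [order2_double], subtracting [T8] and then [T8 *+ 2] where necessary brings the exponent from
    8 to 4 to 2, where [order2_cases] applies. *)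
Lemma torsion_generated (P : E) n : (0 < n)%N -> P *+ n = 0 ->
  exists i j, P = T2 *+ i + T8 *+ j.
Proof.
move=> n0 /(torsion_mul8 uv u0 v0 n0) e8.
have [j1 e4] : exists j, (P - T8 *+ j) *+ 2 *+ 2 = 0.
  have [] := @order2_double (P *+ 2).
  - by rewrite -!mulrnA.
  - by move=> e; exists 0%N; rewrite mulr0n subr0.
  move=> e; exists 1%N.
  by rewrite mulr1n !mulrnBl e -mulrnA subrr.
have [j2 e2] : exists j, (P - T8 *+ j) *+ 2 = 0.
  have [e|e] := order2_double e4; first by exists j1.
  exists (j1 + 2)%N; rewrite mulrnDr opprD addrA mulrnBl e -mulrnA subrr //.
have PE Q : P - T8 *+ j2 = Q -> P = Q + T8 *+ j2 by move=> <-; rewrite subrK.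
have [/PE -> | /PE -> | /PE -> | /PE ->] := order2_cases e2.
- by exists 0%N, j2; rewrite mulr0n.
- by exists 0%N, (4 + j2)%N; rewrite mulr0n add0r (mulrnDr T8 4 j2).
- by exists 1%N, j2; rewrite mulr1n.
- by exists 1%N, (4 + j2)%N; rewrite mulr1n (mulrnDr T8 4 j2) -[LHS]addrA.
Qed.

Definition gen_map (z : 'Z_2 * 'Z_8) : E := T2 *+ z.1 + T8 *+ z.2.

Lemma mulrn_modn (P : E) m k : P *+ m = 0 -> P *+ (k %% m) = P *+ k.
Proof.
by move=> Pm; rewrite {2}(divn_eq k m) mulrnDr mulnC mulrnA Pm mul0rn add0r.
Qed.

Lemma gen_mapD z t : gen_map (z + t) = gen_map z + gen_map t.
Proof.
rewrite /gen_map /= !(mulrn_modn _ T2_2) !(mulrn_modn _ T8_8) !mulrnDr.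
by rewrite addrACA.
Qed.

Lemma gen_map_ker z : gen_map z = 0 -> z = 0.
Proof.
have T8_4 : T8 *+ 4 <> 0 by move/(congr1 val); rewrite val_T8_4.
have T20 : T2 <> 0 by move/(congr1 val).
have T24 : T2 + T8 *+ 4 <> 0 by move/(congr1 val); rewrite val_T2_T8_4.
case: z => i j; rewrite /gen_map /= => e.
(* Doubling removes [T2]. Taking [k = 2] for odd j and [k = 1] for j = 2, 6 would give
   [T8 *+ 4 = 0]; only j = 0 and j = 4 remain. *)
have e2 k : T8 *+ ((2 * k * j) %% 8) = 0.
  have := congr1 (fun Q => Q *+ 2) e.
  rewrite mulrnDl mul0rn -!mulrnA (mulnC i) mulrnA T2_2 mul0rn add0r => h.
  by rewrite (mulrn_modn _ T8_8) mulnC mulnCA mulnA mulrnA mulnC h mul0rn.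
case: j e e2 => [[|[|[|[|[|[|[|[|j]]]]]]]] //= jlt] e e2;
  try by [have := e2 1%N | have := e2 2].
  case: i e => [[|[|i]] //= ilt] e; by congr (_, _); apply: val_inj.
case: i e => [[|[|i]] //= ilt] e.
by case: T8_4; rewrite -e mulr0n add0r.
Qed.

Lemma gen_map_inj : injective gen_map.
Proof.
move=> z t e; apply/eqP; rewrite -subr_eq0; apply/eqP/gen_map_ker.
by apply: (addIr (gen_map t)); rewrite -gen_mapD subrK add0r.
Qed.

Lemma torsion_Z2xZ8_uv : torsion_Z2xZ8 (M + N) (M * N).
Proof.
exists (fun z => val (gen_map z)); split; first by move=> z t /val_inj /gen_map_inj.
split; first by move=> z t; rewrite gen_mapD.
move=> P; rewrite (is_torsionP ns); split=> [[Q [n [<- n0 Qn]]]|[z <-]].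
  have [i [j ->]] := torsion_generated n0 Qn.
  exists (inZp i, inZp j); congr val.
  by rewrite /gen_map /= !(mulrn_modn _ T2_2) !(mulrn_modn _ T8_8).
exists (gen_map z), 8; split=> //.
by rewrite mulrnDl -!mulrnA mulnC (mulnC z.2) !mulrnA T8_8 mul0rn addr0 (mulrnA T2 2 4) T2_2 !mul0rn.
Qed.
End TorsionGroup.

(** * The family E_a *)

Definition ec_scale (c : rat) (P : point) : point :=
  if P is Some (x, y) then Some (c ^+ 2 * x, c ^+ 3 * y) else None.

Section Scaling.
Variables (A B c : rat).
Hypothesis c0 : c != 0.
Local Notation A' := (c ^+ 2 * A).
Local Notation B' := (c ^+ 4 * B).

Lemma ec_scaleK : cancel (ec_scale c) (ec_scale c^-1).
Proof. by case=> [[x y]|] //=; congr (Some (_, _)); field. Qed.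

Lemma ec_scaleVK : cancel (ec_scale c^-1) (ec_scale c).
Proof. by case=> [[x y]|] //=; congr (Some (_, _)); field. Qed.

Lemma on_ec_scale P : on_curve A' B' (ec_scale c P) = on_curve A B P.
Proof.
case: P => [[x y]|] //=.
have c6 : c ^+ 6 != 0 by rewrite expf_neq0.
rewrite -(inj_eq (mulfI c6) (y ^+ 2)); congr (_ == _); ring.
Qed.

Lemma ec_add_scale P Q :
  ec_add A' B' (ec_scale c P) (ec_scale c Q) = ec_scale c (ec_add A B P Q).
Proof.
case: P Q => [[x1 y1]|] [[x2 y2]|] //=.
have c2 : c ^+ 2 != 0 by rewrite expf_neq0.
have c3 : c ^+ 3 != 0 by rewrite expf_neq0.
rewrite (inj_eq (mulfI c2)) -mulrN (inj_eq (mulfI c3)); case: ifP => // _.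
set l' := if x1 == x2 then _ else _; set l := if x1 == x2 then _ else _.
have -> : l = c * l'.
  rewrite /l /l'; case: eqVneq => [_|x12]; last first.
    have hd : x2 - x1 != 0 by rewrite subr_eq0 eq_sym.
    by field; rewrite hd -mulrBr mulf_neq0.
  rewrite (_ : 2 * (c ^+ 3 * y1) = c ^+ 3 * (2 * y1)); last by ring.
  by rewrite invfM; move: (2 * y1)^-1 => z; field.
by congr (Some (_, _)); ring.
Qed.

Lemma ec_mul_scale n P : ec_mul A' B' n (ec_scale c P) = ec_scale c (ec_mul A B n P).
Proof. by elim: n => [|n IH] //=; rewrite IH ec_add_scale. Qed.

Lemma is_torsion_scale P : is_torsion A' B' (ec_scale c P) <-> is_torsion A B P.
Proof.
rewrite /is_torsion on_ec_scale; split=> -[onP [n [n0 e]]]; split=> //; exists n; split=> //.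
  by apply: (can_inj ec_scaleK); rewrite -ec_mul_scale.
by rewrite ec_mul_scale e.
Qed.

Lemma torsion_Z2xZ8_scale : torsion_Z2xZ8 A B -> torsion_Z2xZ8 A' B'.
Proof.
move=> [f [finj [fD fT]]]; exists (fun z => ec_scale c (f z)); split.
  by move=> z t /(can_inj ec_scaleK) /finj.
split=> [z t|P]; first by rewrite fD ec_add_scale.
rewrite -[P]ec_scaleVK is_torsion_scale fT.
by split=> -[z e]; exists z; [rewrite e | apply: (can_inj ec_scaleK)].
Qed.
End Scaling.

(** * From the torsion structure to the parameter r *)

Lemma torsion_Z2xZ8_root A B : disc A B != 0 -> torsion_Z2xZ8 A B ->
  exists x, x ^+ 2 + A * x + B = 0.
Proof.
move=> ns [f [finj [fD fT]]].
have val_f z : exists Q : ecgroup ns, val Q = f z.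
  have /(is_torsionP ns) [Q [n [QE _ _]]] : is_torsion A B (f z) by apply/fT; exists z.
  by exists Q.
have f0 : f 0 = None.
  have [Q QE] := val_f 0; have : Q + Q = Q.
    by apply: val_inj; rewrite val_ecD QE -fD addr0.
  by move=> /(canRL (addrK _)); rewrite subrr => Q0; rewrite -QE Q0.
have two z : z + z = 0 -> z != 0 -> exists x, f z = Some (x, 0) /\ x * (x ^+ 2 + A * x + B) = 0.
  move=> zz z0; have [Q QE] := val_f z; have := valP Q; rewrite QE.
  have := fD z z; rewrite zz f0 => /esym /ec_add_eq_None.
  case fz: (f z) => [[x y]|]; last by case/eqP: z0; apply: finj; rewrite f0.
  move=> [yE] /eqP e; have y0 : y = 0 by lra.
  by exists x; rewrite y0; split=> //; rewrite y0 in e; linear_combination (esym e).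
(* Of two distinct points of order two, at most one is (0, 0). *)
have [|//|x1 [e1 r1]] := two (1, 0); first exact/eqP.
have [|//|x2 [e2 r2]] := two (0, 4); first exact/eqP.
have : x1 != x2.
  by apply/eqP => x12; have /finj [] : f (1, 0) = f (0, 4) by rewrite e1 e2 x12.
case: (eqVneq x1 0) r1 => [-> _|x10].
  by rewrite eq_sym => x20; move/eqP: r2; rewrite mulf_eq0 (negPf x20) => /eqP; exists x2.
by move/eqP; rewrite mulf_eq0 (negPf x10) => /eqP; exists x1.
Qed.

Lemma disc_EAB a : disc (EA a) (EB a) =
  16 * (16 * a ^+ 4) ^+ 2 * ((a - 1) ^+ 4 * (a + 1) ^+ 2 * (a ^+ 2 - 6 * a + 1)).
Proof. by rewrite /disc /EA /EB; ring. Qed.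

Lemma disc_EAB_neq0 a : disc (EA a) (EB a) != 0 -> [/\ a != 0, a != 1 & a != - 1].
Proof. by rewrite disc_EAB => h; split; apply: contraNneq h => ->; apply/eqP; ring. Qed.

Lemma param_admissible (a r : rat) : a != 0 -> a * (r * (r - 1)) = - (r + 1) ->
  [/\ r != 0, r != 1 & r != - 1].
Proof.
move=> a0 e; split; apply/eqP => h; rewrite {}h in e; [lra|lra|].
by case/eqP: a0; lra.
Qed.

Lemma torsion_param a : disc (EA a) (EB a) != 0 -> torsion_Z2xZ8 (EA a) (EB a) ->
  exists r : rat, [/\ r != 0, r != 1, r != -1 & a = - (r + 1) / (r * (r - 1))].
Proof.
move=> ns /(torsion_Z2xZ8_root ns) [x xE]; have [a0 a1 a2] := disc_EAB_neq0 ns.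
have am : a - 1 != 0 by rewrite subr_eq0.
have ap : a + 1 != 0 by rewrite addr_eq0.
(* The discriminant of the quadratic is (a - 1)^4 (a + 1)^2 (a^2 - 6 a + 1), so its root, divided by
   (a - 1)^2 (a + 1), squares to the last factor. *)
pose s := (2 * x + EA a) / ((a - 1) ^+ 2 * (a + 1)).
have sE : s ^+ 2 = a ^+ 2 - 6 * a + 1.
  have h : (2 * x + EA a) ^+ 2 = (a - 1) ^+ 4 * (a + 1) ^+ 2 * (a ^+ 2 - 6 * a + 1).
    rewrite /EA /EB in xE *; linear_combination (eqM 4 xE).
  by rewrite /s expr_div_n h; field; rewrite am ap.
(* A root of a r^2 - (a - 1) r + 1, whose discriminant is a^2 - 6 a + 1. *)
pose r := (a - 1 + s) / (2 * a).
have rE : a * (r * (r - 1)) = - (r + 1).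
  have : a * r ^+ 2 - a * r + r + 1 = (s ^+ 2 - (a ^+ 2 - 6 * a + 1)) / (4 * a).
    by rewrite /r; field.
  by rewrite sE subrr mul0r => h; linear_combination h.
have [r0 r1 r2] := param_admissible a0 rE.
exists r; split=> //; rewrite -rE mulfK // mulf_neq0 // subr_eq0 //.
Qed.

Unset Implicit Arguments.

Theorem theorem8p2 (a : rat) :
  disc (EA a) (EB a) != 0 ->
  (torsion_Z2xZ8 (EA a) (EB a) <->
   exists r : rat, [/\ r != 0, r != 1, r != -1 & a = - (r + 1) / (r * (r - 1))]).
Proof.
move=> ns; split; first exact: torsion_param.
move=> [r [r0 r1 r2 aE]].
have rm : r - 1 != 0 by rewrite subr_eq0.
have rp : r + 1 != 0 by rewrite addr_eq0.
have rr : r ^+ 2 - 1 != 0 by rewrite (_ : r ^+ 2 - 1 = (r - 1) * (r + 1)) ?mulf_neq0 //; ring.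
pose q := 2 * r / (r ^+ 2 - 1).
(* Signs may be dropped, as the curve and the condition on u^2 + v^2 involve only even powers. *)
pose u := `|numq q|%N; pose v := `|denq q|%N.
have qE : q * (r ^+ 2 - 1) = 2 * r by rewrite /q divfK.
have q0 : q != 0 by rewrite mulf_neq0 ?invr_neq0 // mulf_neq0.
pose d : rat := (denq q)%:~R; pose n : rat := (numq q)%:~R.
have d0 : d != 0 by rewrite intr_eq0 denq_neq0.
have nd : n = q * d by rewrite /n numqE.
have u2 : u%:R ^+ 2 = n ^+ 2 :> rat by rewrite natr_absz intr_norm real_normK ?num_real.
have v2 : v%:R ^+ 2 = d ^+ 2 :> rat by rewrite natr_absz intr_norm real_normK ?num_real.
have u4 : u%:R ^+ 4 = n ^+ 4 :> rat by rewrite -[4%N]/(2 * 2)%N !exprM u2.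
have v4 : v%:R ^+ 4 = d ^+ 4 :> rat by rewrite -[4%N]/(2 * 2)%N !exprM v2.
pose k := (r ^+ 2 - 1) / d.
have k0 : k != 0 by rewrite mulf_neq0 ?invr_neq0.
have dk : d = (r ^+ 2 - 1) / k by rewrite /k invf_div mulrCA mulfV ?mulr1.
have nk : n = 2 * r / k by rewrite nd dk mulrA qE.
(* From (2 r)^2 + (r^2 - 1)^2 = (r^2 + 1)^2, divided by k^2. *)
pose w := (r ^+ 2 + 1) / `|k|.
have w0 : 0 < w.
  by rewrite divr_gt0 ?normr_gt0 // ltr_wpDl ?ltr01 // sqr_ge0.
have uvw : u%:R ^+ 2 + v%:R ^+ 2 = w ^+ 2 :> rat.
  by rewrite u2 v2 /w expr_div_n real_normK ?num_real // nk dk; field.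
(* Comparing the coefficients of x forces c n d = 2 a up to sign; this choice gives c n d = - 2
   a. *)
pose c := k ^+ 2 / (r ^+ 2 * (r - 1) ^+ 2).
have c0 : c != 0 by rewrite mulf_neq0 ?expf_neq0 // invr_neq0 // mulf_neq0 ?expf_neq0.
have AE : EA a = c ^+ 2 * (u%:R ^+ 4 + v%:R ^+ 4).
  by rewrite u4 v4 nk dk /c /EA aE; field; rewrite k0 r0 rm.
have BE : EB a = c ^+ 4 * (u%:R ^+ 4 * v%:R ^+ 4).
  by rewrite u4 v4 nk dk /c /EB aE; field; rewrite k0 r0 rm.
rewrite AE BE in ns *; apply: torsion_Z2xZ8_scale => //.
apply: (@torsion_Z2xZ8_uv _ _ w) => //.
- exact: coprime_num_den.
- by rewrite absz_gt0 numq_eq0.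
- by rewrite absz_gt0 denq_neq0.
(* The discriminant has weight 12 under scaling. *)
apply: contra ns; rewrite /disc => /eqP h; apply/eqP.
by linear_combination (eqM (c ^+ 12) h).
Qed.
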